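(* Let $k\ge1$, let $\overline n=(n_1,\ldots,n_k)$ with $n_1\ge\cdots\ge n_k\ge0$ integers, let $\overline H=(H_1,\ldots,H_k)$ with $H_i=(d_{i,0},d_{i,1},\ldots)$ sequences of non-negative integers, $\sum_{j\ge0}d_{i,j}=n_i$, let $n=\sum_{i=1}^kn_i$, and let $H=(d_0,d_1,\ldots)$ with $d_{i+kj}=d_{i+1,j}$ for $0\le i<k$, $j\ge0$. Let $E(\overline H)=\{i\in\mathbb Z_{\ge0}\mid d_{1,i}=\cdots=d_{k,i}\}$ and suppose that for any two numbers $i,j\in\mathbb Z_{\ge0}\setminus E(\overline H)$ with $i<j$ we have $j-i\ge2$. Then the map $\pi\colon(\mathbb C^2)^{[n]}_{1,k}(H)\to(\mathbb C^2)^{[\overline n]}_{1,1}(\overline H)$ is an isomorphism.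
   Context: $(\mathbb C^2)^{[n]}_{1,k}(H)$ is the variety of ideals $I\subset\mathbb C[x,y]$ of colength $n$ that are quasi-homogeneous for the grading $\deg x=1$, $\deg y=k$, and such that the degree-$i$ part of $\mathbb C[x,y]/I$ has dimension $d_i$ for all $i$. $(\mathbb C^2)^{[\overline n]}_{1,1}(\overline H)$ is the variety of tuples $(I_1,\ldots,I_k)$ of homogeneous ideals ($\deg x=\deg y=1$) with $I_j\subset I_h$ for $j<h$ and such that the degree-$h$ part of $\mathbb C[x,y]/I_j$ has dimension $d_{j,h}$ for all $j,h$. Quiver descriptions. (1) Put $V_j=\mathbb C^{d_j}$. Then $(\mathbb C^2)^{[n]}_{1,k}(H)$ is identified with the set of data $((B_{1,j},B_{2,j})_{j\ge0},i)$, $B_{1,j}\in\mathrm{Hom}(V_j,V_{j+1})$, $B_{2,j}\in\mathrm{Hom}(V_j,V_{j+k})$, $i\in\mathrm{Hom}(\mathbb C,V_0)$, satisfying $B_{1,j+k}B_{2,j}=B_{2,j+1}B_{1,j}$ and the stability condition that there is no graded subspace $S\subsetneq\bigoplus_jV_j$ with $B_\alpha(S)\subset S$ ($\alpha=1,2$) and $\mathrm{im}(i)\subset S$, modulo $\prod_jGL_{d_j}(\mathbb C)$. (2) Put $V_{j,h}=\mathbb C^{d_{j,h}}$. Then $(\mathbb C^2)^{[\overline n]}_{1,1}(\overline H)$ is identified with the set of data $((C_{1,j,h},C_{2,j,h})_{1\le j\le k,\,h\ge0},(p_{j,h})_{1\le j\le k-1,\,h\ge0},i)$, $C_{\alpha,j,h}\in\mathrm{Hom}(V_{j,h},V_{j,h+1})$,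 $p_{j,h}\in\mathrm{Hom}(V_{j,h},V_{j+1,h})$, $i\in\mathrm{Hom}(\mathbb C,V_{1,0})$, satisfying $C_{1,j,h+1}C_{2,j,h}=C_{2,j,h+1}C_{1,j,h}$, $C_{\alpha,j+1,h}p_{j,h}=p_{j,h+1}C_{\alpha,j,h}$, and the stability condition that there is no graded subspace $S\subsetneq\bigoplus_{j,h}V_{j,h}$ with $C_\alpha(S)\subset S$, $p(S)\subset S$, $\mathrm{im}(i)\subset S$, modulo $\prod_{j,h}GL_{d_{j,h}}(\mathbb C)$. The map $\pi$. Identify $V_{j,h}=V_{j-1+kh}$ for $1\le j\le k$, $h\ge0$. Then $\pi\colon(B_1,B_2,i)\mapsto(C_1,C_2,p,i)$ with $C_1=B_1^k$, $C_2=B_2$, $p=B_1$; that is, $C_{1,j,h}$ is the composition $V_{j-1+kh}\to V_{j-1+k(h+1)}$ of $k$ consecutive maps $B_1$, $C_{2,j,h}=B_{2,j-1+kh}$, and $p_{j,h}=B_{1,j-1+kh}$. *)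

(* Defs.v *)
From mathcomp Require Import all_boot all_order all_algebra.
From mathcomp Require Import mpoly.
From mathcomp Require Import boolp classical_sets reals complex.
From HB Require Import structures.
From mathcomp Require Import zify.

Set Implicit Arguments.
Unset Strict Implicit.
Unset Printing Implicit Defensive.

Import GRing.Theory.
Local Open Scope ring_scope.

(* Varieties are classical (reduced) ones: a set of closed points with its
   Zariski open subsets and the regular functions on them.  Only the values of
   [f] on [U] matter in [regular U f]. *)
Record variety (F : fieldType) := Variety {
  point :> Type;
  zopen : set point -> Prop;
  regular : set point -> (point -> F) -> Prop }.

Definition is_morphism (F : fieldType) (X Y : variety F) (g : X -> Y) : Prop :=
  forall V : set Y, zopen V ->
    zopen (fun x => V (g x)) /\
    forall f : Y -> F, regular V f -> regular (fun x => V (g x)) (f \o g).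

Definition is_isomorphism (F : fieldType) (X Y : variety F) (g : X -> Y) : Prop :=
  is_morphism g /\
  exists g' : Y -> X, [/\ is_morphism g', cancel g g' & cancel g' g].

Section Quotient.
Variables (F : fieldType) (X : Type).
(* [coord] are the coordinates of the affine space [X]. *)
Variable coord : (X -> F) -> Prop.

Inductive polyfun : (X -> F) -> Prop :=
  | polyfun_const c : polyfun (fun=> c)
  | polyfun_coord f : coord f -> polyfun f
  | polyfun_add f g : polyfun f -> polyfun g -> polyfun (fun x => f x + g x)
  | polyfun_mul f g : polyfun f -> polyfun g -> polyfun (fun x => f x * g x).

Variables (Z : Type) (chart : X -> Z -> Prop).

(* [chart x z] is the graph of a surjection onto [Z] from a locally closed
   subset of [X] (those [x] related to some [z]), whose fibres are the orbits of
   a group; see [data_ideal_surj], [data_ideal_fibre], [data_equiv_ideal] and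
   their nested analogues.  [Z] gets the geometric quotient structure: a subset is open when
   its preimage is, and a function is regular when its pullback is, that is,
   when the pullback is locally a quotient of two polynomials. *)
Definition quotient_open (V : set Z) : Prop :=
  forall x z, chart x z -> V z ->
    exists b, [/\ polyfun b, b x != 0 &
      forall x' z', chart x' z' -> b x' != 0 -> V z'].

Definition quotient_regular (V : set Z) (f : Z -> F) : Prop :=
  forall x z, chart x z -> V z ->
    exists a b, [/\ polyfun a, polyfun b, b x != 0 &
      forall x' z', chart x' z' -> V z' -> b x' != 0 -> f z' = a x' / b x'].

Definition quotient_variety : variety F :=
  Variety quotient_open quotient_regular.

End Quotient.

Section Ideals.
Variable F : fieldType.
Notation P := {mpoly F[2]}.

Definition px : P := 'X_ord0.
Definition py : P := 'X_ord_max.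

Definition wdeg (k : nat) (m : 'X_{1..2}) : nat := (m ord0 + k * m ord_max)%N.

Definition whomog (k j : nat) (f : P) : Prop :=
  forall m, m \in msupp f -> wdeg k m = j.

Definition wcomp (k j : nat) (f : P) : P :=
  \sum_(m <- msupp f | wdeg k m == j) f@_m *: 'X_[m].

Definition is_ideal (I : set P) : Prop :=
  [/\ I 0, forall f g, I f -> I g -> I (f + g) & forall f g, I g -> I (f * g)].

Definition is_whomog_ideal (k : nat) (I : set P) : Prop :=
  is_ideal I /\ forall f j, I f -> I (wcomp k j f).

(* [S / (S :&: I)] has dimension [n]: it has a basis with [n] elements. *)
Definition quot_dim (S I : set P) (n : nat) : Prop :=
  exists e : 'I_n -> P, (forall a, S (e a)) /\
    forall f, S f -> exists! c : 'cV[F]_n, I (f - \sum_(a < n) c a 0 *: e a).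

Definition hilb_ideal (k n : nat) (d : nat -> nat) (I : set P) : Prop :=
  [/\ is_whomog_ideal k I, quot_dim setT I n &
      forall j, quot_dim (whomog k j) I (d j)].

Definition nested_ideals (k : nat) (db : 'I_k -> nat -> nat)
    (J : 'I_k -> set P) : Prop :=
  [/\ forall j, is_whomog_ideal 1 (J j),
      forall j h : 'I_k, (j < h)%N -> (J j `<=` J h)%classic &
      forall j h, quot_dim (whomog 1 h) (J j) (db j h)].

End Ideals.

Section Quotients.
Variable F : fieldType.
Notation P := {mpoly F[2]}.

Lemma whomog_lin k j (c : F) (f g : P) :
  whomog k j f -> whomog k j g -> whomog k j (c *: f + g).
Proof.
move=> hf hg m /msuppD_le; rewrite mem_cat => /orP[/msuppZ_le|]; [exact: hf|exact: hg].
Qed.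
Lemma whomog0 k j : whomog k j (0 : P).
Proof. by move=> m; rewrite msupp0. Qed.

Lemma quot_factor k j n m (q : {linear P -> 'cV[F]_n}) (t : P -> 'cV[F]_m) :
  linear t ->
  (forall v, exists2 f, whomog k j f & q f = v) ->
  (forall f, whomog k j f -> q f = 0 -> t f = 0) ->
  exists A : 'M[F]_(m, n), forall f, whomog k j f -> t f = A *m q f.
Proof.
move=> tl qs qt.
have t0 : t 0 = 0 by apply: qt; [exact: whomog0|exact: linear0].
pose e b := s2val (cid2 (qs (delta_mx b 0))).
have He b : whomog k j (e b) /\ q (e b) = delta_mx b 0.
  by split; [exact: s2valP (cid2 (qs (delta_mx b 0)))|exact: s2valP' (cid2 (qs (delta_mx b 0)))].
exists (\matrix_(i, b) t (e b) i 0) => f hf.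
have key (s : seq 'I_n) c : whomog k j (\sum_(b <- s) c b *: e b) /\
   t (\sum_(b <- s) c b *: e b) = \sum_(b <- s) c b *: t (e b).
  elim: s => [|b s [IH1 IH2]]; first by rewrite !big_nil; split=> //; exact: whomog0.
  rewrite !big_cons; split; first by apply: whomog_lin => //; case: (He b).
  by rewrite tl IH2.
have [h1 h2] := key (index_enum 'I_n) (fun b => q f b 0).
set s := \sum_(b <- _) _ in h1 h2.
have qs0 : q s = q f.
  rewrite /s linear_sum /=; apply/matrixP => i z; rewrite ord1 summxE (bigD1 i) //= linearZ /= (He i).2 !mxE !eqxx mulr1.
  by rewrite big1 ?addr0 // => b bi; rewrite linearZ /= (He b).2 !mxE eq_sym (negPf bi) mulr0.
have := qt _ (@whomog_lin k j (-1) _ _ h1 hf); rewrite tl h2.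
rewrite linearP /= qs0 scaleN1r addNr => /(_ erefl) /eqP.
rewrite scaleN1r addrC subr_eq0 => /eqP ->.
apply/matrixP => i z; rewrite ord1 summxE mxE; apply: eq_bigr => b _.
by rewrite !mxE mulrC.
Qed.

Lemma wdegD k m m' : wdeg k (m + m')%MM = (wdeg k m + wdeg k m')%N.
Proof. by rewrite /wdeg !mnmDE mulnDr addnACA. Qed.

Lemma whomog_px k j (f : P) : whomog k j f -> whomog k j.+1 (px F * f).
Proof.
move=> hf m; rewrite mulrC (perm_mem (msuppMX _ _)) => /mapP[m' /hf <- ->].
by rewrite wdegD /wdeg !mnm1E /= ?eqxx; lia.
Qed.
Lemma whomog_py k j (f : P) : whomog k j f -> whomog k (j + k) (py F * f).
Proof.
move=> hf m; rewrite mulrC (perm_mem (msuppMX _ _)) => /mapP[m' /hf <- ->].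
by rewrite wdegD /wdeg !mnm1E /= ?eqxx; lia.
Qed.
Lemma whomog_1 k : whomog k 0 (1 : P).
Proof. by move=> m; rewrite msupp1 inE => /eqP ->; rewrite /wdeg !mnmE muln0. Qed.

Lemma quot_map_unique k j n (q q' : {linear P -> 'cV[F]_n}) (I : set P) :
  (forall v, exists2 f, whomog k j f & q f = v) ->
  (forall v, exists2 f, whomog k j f & q' f = v) ->
  (forall f, whomog k j f -> (q f = 0 <-> I f)) ->
  (forall f, whomog k j f -> (q' f = 0 <-> I f)) ->
  {g : 'M[F]_n | g \in unitmx /\ forall f, whomog k j f -> q' f = g *m q f}.
Proof.
move=> s s' e e'; apply: cid.
have [|g Hg] := quot_factor (linearP q') s; first by move=> f hf /(e _ hf)/(e' _ hf).
have [|g' Hg'] := quot_factor (linearP q) s'; first by move=> f hf /(e' _ hf)/(e _ hf).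
exists g; split=> //; have : g' *m g = 1%:M; last by case/mulmx1_unit.
apply/trmx_inj/row_matrixP => i; apply/trmx_inj.
rewrite -!tr_col !trmxK !colE.
have [f hf <-] := s (delta_mx i 0).
by rewrite -mulmxA -Hg // -Hg' // mul1mx.
Qed.

Lemma ext_q k j n m (q : P -> 'cV[F]_n) (A B : 'M[F]_(m, n)) :
  (forall v, exists2 f, whomog k j f & q f = v) ->
  (forall f, whomog k j f -> A *m q f = B *m q f) -> A = B.
Proof.
move=> s h; apply/trmx_inj/row_matrixP => i; apply/trmx_inj.
rewrite -!tr_col !trmxK !colE.
by have [f hf <-] := s (delta_mx i 0); apply: h.
Qed.

Lemma wcomp_big k j (f : P) (e : seq 'X_{1..2}) : uniq e -> {subset msupp f <= e} ->
  wcomp k j f = \sum_(m <- e | wdeg k m == j) f@_m *: 'X_[m].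
Proof.
move=> ue se; rewrite /wcomp [RHS](bigID (mem (msupp f))) /= [X in _ + X]big1 ?addr0; last first.
  by move=> m /andP[_ /memN_msupp_eq0 ->]; rewrite scale0r.
rewrite -big_filter -[RHS]big_filter; apply: perm_big; apply: uniq_perm.
- by rewrite filter_uniq ?msupp_uniq.
- by rewrite filter_uniq.
- move=> m; rewrite !mem_filter /=; case: (m \in msupp f) (se m) => [/(_ isT) ->|]; rewrite ?andbT ?andbF //.
Qed.

Lemma wcomp_lin k j : linear (@wcomp F k j).
Proof.
move=> c f g; pose e := undup (msupp f ++ msupp g ++ msupp (c *: f + g)).
have ue : uniq e by exact: undup_uniq.
rewrite !(@wcomp_big k j _ e) //; try by move=> m; rewrite mem_undup !mem_cat => ->; rewrite ?orbT.
rewrite scaler_sumr -big_split /=; apply: eq_bigr => m _.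
by rewrite mcoeffD mcoeffZ scalerDl scalerA.
Qed.

Lemma wcomp_id k j (f : P) : whomog k j f -> wcomp k j f = f.
Proof.
move=> hf; rewrite /wcomp [RHS]mpolyE big_seq_cond [RHS]big_seq; apply: eq_bigl => m.
by case: (boolP (m \in _)) => //= /hf ->; rewrite eqxx.
Qed.

Lemma wcomp_homog k j (f : P) : whomog k j (wcomp k j f).
Proof.
rewrite /wcomp -big_filter.
have : forall m, m \in [seq m <- msupp f | wdeg k m == j] -> wdeg k m = j.
  by move=> m; rewrite mem_filter => /andP[/eqP].
elim: [seq _ <- _ | _] => [_|m s IH hs]; first by rewrite big_nil; exact: whomog0.
rewrite big_cons; apply: whomog_lin; last by apply: IH => z zs; apply: hs; rewrite inE zs orbT.
by move=> z; rewrite msuppX inE => /eqP ->; apply: hs; rewrite mem_head.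
Qed.

Lemma quot_map k j n (I : set P) : is_ideal I -> quot_dim (whomog k j) I n ->
  {q : {linear P -> 'cV[F]_n} |
    (forall f, whomog k j f -> (q f = 0 <-> I f)) /\
    (forall v, exists2 f, whomog k j f & q f = v)}.
Proof.
move=> [I0 ID IM] qd; apply: cid; move: qd => [e [he hc]].
have IZ (c : F) f : I f -> I (c *: f).
  by move=> If; rewrite -[f]mul1r scalerAl; apply: IM.
pose c (f : P) := projT1 (cid (hc _ (@wcomp_homog k j f))).
have Hc f : I (wcomp k j f - \sum_(a < n) c f a 0 *: e a) /\
   forall v : 'cV_n, I (wcomp k j f - \sum_(a < n) v a 0 *: e a) -> c f = v.
  by rewrite /c; case: (cid _) => y [h1 h2].
have cl : linear c.
  move=> a f g; apply: (Hc _).2; have := ID _ _ (IZ a _ (Hc f).1) (Hc g).1.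
  have -> : \sum_(i < n) (a *: c f + c g) i 0 *: e i =
     a *: (\sum_(i < n) c f i 0 *: e i) + \sum_(i < n) c g i 0 *: e i.
    rewrite scaler_sumr -big_split /=.
    by apply: eq_bigr => i _; rewrite !mxE scalerDl scalerA.
  by rewrite wcomp_lin scalerBr addrACA -opprD.
pose L := GRing.isLinear.Build _ _ _ _ c cl.
pose q : {linear P -> 'cV[F]_n} := HB.pack c L.
have z0 : \sum_(a < n) (0 : 'cV[F]_n) a 0 *: e a = 0.
  by rewrite big1 // => a _; rewrite mxE scale0r.
exists q; split.
- move=> f hf; have [h1 h2] := Hc f; rewrite wcomp_id // in h1 h2; split.
    by move=> qf; move: h1; rewrite -[c f]/(q f) qf z0 subr0.
  by move=> If; apply: h2; rewrite z0 subr0.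
- move=> v; have hs : whomog k j (\sum_(a < n) v a 0 *: e a).
    elim: (index_enum _) => [|a s IH]; first by rewrite big_nil; exact: whomog0.
    by rewrite big_cons; exact: whomog_lin.
  exists (\sum_(a < n) v a 0 *: e a) => //.
  by apply: (Hc _).2; rewrite wcomp_id // subrr.
Qed.


End Quotients.

Section QuasiHomogeneous.
Variables (F : fieldType) (k : nat) (d : nat -> nat).

Record data := Data {
  B1 : forall j, 'M[F]_(d j.+1, d j);
  B2 : forall j, 'M[F]_(d (j + k), d j);
  fr : 'cV[F]_(d 0) }.

Inductive data_coord : (data -> F) -> Prop :=
  | coord_B1 j a b : data_coord (fun x => B1 x j a b)
  | coord_B2 j a b : data_coord (fun x => B2 x j a b)
  | coord_fr a : data_coord (fun x => fr x a 0).

Definition data_rel (x : data) : Prop :=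
  forall j, B1 x (j + k) *m B2 x j = B2 x j.+1 *m B1 x j.

Definition data_stable (x : data) : Prop :=
  forall S : forall j, {vspace 'cV[F]_(d j)},
    (forall j v, v \in S j -> B1 x j *m v \in S j.+1) ->
    (forall j v, v \in S j -> B2 x j *m v \in S (j + k)%N) ->
    fr x \in S 0%N ->
    forall j, S j = fullv.

(* [x] and [I] correspond to each other: [V_j] is the degree [j] part of the
   quotient by [I], [B1] and [B2] are the multiplications by the two variables
   and [fr] is the class of [1]; [q j] is the quotient map in degree [j] (its
   values on other polynomials are irrelevant). *)
Definition data_ideal (x : data) (I : set {mpoly F[2]}) : Prop :=
  exists q : forall j, {linear {mpoly F[2]} -> 'cV[F]_(d j)},
    [/\ forall j f, whomog k j f -> (q j f = 0 <-> I f),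
        forall j v, exists2 f, whomog k j f & q j f = v,
        forall j f, whomog k j f -> q j.+1 (px F * f) = B1 x j *m q j f,
        forall j f, whomog k j f -> q (j + k)%N (py F * f) = B2 x j *m q j f &
        q 0%N 1 = fr x].

(* Being in the same orbit of the product of the groups [GL_(d j)]. *)
Definition data_equiv (x x' : data) : Prop :=
  exists g : forall j, 'M[F]_(d j),
    [/\ forall j, g j \in unitmx,
        forall j, B1 x' j *m g j = g j.+1 *m B1 x j,
        forall j, B2 x' j *m g j = g (j + k)%N *m B2 x j &
        fr x' = g 0%N *m fr x].

Lemma data_ideal_fibre (x x' : data) I : data_ideal x I -> data_ideal x' I -> data_equiv x x'.
Proof.
move=> [q [e s q1 q2 q0]] [q' [e' s' q1' q2' q0']].
pose g j := sval (quot_map_unique (s j) (s' j) (e j) (e' j)).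
have Hg j : g j \in unitmx /\ forall f, whomog k j f -> q' j f = g j *m q j f.
  exact: svalP (quot_map_unique (s j) (s' j) (e j) (e' j)).
exists g; split.
- by move=> j; case: (Hg j).
- move=> j; apply: (ext_q (s j)) => f hf; rewrite -!mulmxA -q1 // -(Hg j).2 // -q1' // (Hg _).2 //.
  exact: whomog_px.
- move=> j; apply: (ext_q (s j)) => f hf; rewrite -!mulmxA -q2 // -(Hg j).2 // -q2' // (Hg _).2 //.
  exact: whomog_py.
- by rewrite -q0 -q0' (Hg 0%N).2 //; exact: whomog_1.
Qed.

Lemma data_equiv_ideal (x x' : data) I : data_ideal x I -> data_equiv x x' -> data_ideal x' I.
Proof.
move=> [q [e s q1 q2 q0]] [g [gu g1 g2 g0]].
exists (fun j => (mulmx (g j)) \o q j); split => /=.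
- move=> j f hf; apply: iff_trans (e j f hf); split; last by move->; rewrite mulmx0.
  by move/(congr1 (mulmx (invmx (g j)))); rewrite mulKmx // mulmx0.
- move=> j v; have [f hf Hf] := s j (invmx (g j) *m v); exists f => //.
  by rewrite /= Hf mulKVmx.
- by move=> j f hf; rewrite q1 // !mulmxA g1.
- by move=> j f hf; rewrite q2 // !mulmxA g2.
- by rewrite q0 -g0.
Qed.

Lemma data_ideal_surj n I : hilb_ideal k n d I -> exists x, data_ideal x I.
Proof.
move=> [[hI _] _ hd]; have [I0 ID IM] := hI.
pose q j := sval (quot_map hI (hd j)).
have Hq j := svalP (quot_map hI (hd j)); rewrite -/(q _) in Hq.
have qi j := (Hq j).1; have qs j := (Hq j).2.
have lx j : linear (fun f : {mpoly F[2]} => q j.+1 (px F * f)).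
  by move=> c f g; rewrite mulrDr -scalerAr linearP.
have ly j : linear (fun f : {mpoly F[2]} => q (j + k)%N (py F * f)).
  by move=> c f g; rewrite mulrDr -scalerAr linearP.
have ex j := quot_factor (lx j) (qs j) (fun f hf q0 => (qi j.+1 _ (whomog_px hf)).2 (IM _ _ ((qi j f hf).1 q0))).
have ey j := quot_factor (ly j) (qs j) (fun f hf q0 => (qi (j+k)%N _ (whomog_py hf)).2 (IM _ _ ((qi j f hf).1 q0))).
exists (Data (fun j => projT1 (cid (ex j))) (fun j => projT1 (cid (ey j))) (q 0%N 1)).
exists q; split=> //.
- by move=> j; exact: projT2 (cid (ex j)).
- by move=> j; exact: projT2 (cid (ey j)).
Qed.

Variable n : nat.

Definition hilb_chart (x : data) (z : {I | hilb_ideal k n d I}) : Prop :=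
  [/\ data_rel x, data_stable x & data_ideal x (sval z)].

Definition hilb : variety F := quotient_variety data_coord hilb_chart.

Fixpoint B1pow (x : data) (m j : nat) : 'M[F]_(d (m + j), d j) :=
  match m return 'M[F]_(d (m + j), d j) with
  | 0 => 1%:M
  | m'.+1 => B1 x (m' + j) *m B1pow x m' j
  end.

End QuasiHomogeneous.

(* The indices [1 <= j <= k] of the nested case are shifted to [j : 'I_k]; the
   [p_j] are indexed by ['I_k.-1] and go from [prevk j = j] to [nextk j = j + 1]. *)
Lemma nextk_subproof k (j : 'I_k.-1) : (j.+1 < k)%N.
Proof. by case: k j => [|k] [j /= hj]. Qed.

Definition prevk k (j : 'I_k.-1) : 'I_k := widen_ord (leq_pred k) j.
Definition nextk k (j : 'I_k.-1) : 'I_k := Ordinal (nextk_subproof j).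
Definition firstk k (hk : (1 <= k)%N) : 'I_k := Ordinal hk.

Section Nested.
Variables (F : fieldType) (k : nat) (hk : (1 <= k)%N) (db : 'I_k -> nat -> nat).

Record ndata := NData {
  C1 : forall (j : 'I_k) h, 'M[F]_(db j h.+1, db j h);
  C2 : forall (j : 'I_k) h, 'M[F]_(db j h.+1, db j h);
  pr : forall (j : 'I_k.-1) h, 'M[F]_(db (nextk j) h, db (prevk j) h);
  nfr : 'cV[F]_(db (firstk hk) 0) }.

Inductive ndata_coord : (ndata -> F) -> Prop :=
  | coord_C1 j h a b : ndata_coord (fun y => C1 y j h a b)
  | coord_C2 j h a b : ndata_coord (fun y => C2 y j h a b)
  | coord_pr j h a b : ndata_coord (fun y => pr y j h a b)
  | coord_nfr a : ndata_coord (fun y => nfr y a 0).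

Definition ndata_rel (y : ndata) : Prop :=
  [/\ forall j h, C1 y j h.+1 *m C2 y j h = C2 y j h.+1 *m C1 y j h,
      forall j h, C1 y (nextk j) h *m pr y j h = pr y j h.+1 *m C1 y (prevk j) h &
      forall j h, C2 y (nextk j) h *m pr y j h = pr y j h.+1 *m C2 y (prevk j) h].

Definition ndata_stable (y : ndata) : Prop :=
  forall S : forall j h, {vspace 'cV[F]_(db j h)},
    (forall j h v, v \in S j h -> C1 y j h *m v \in S j h.+1) ->
    (forall j h v, v \in S j h -> C2 y j h *m v \in S j h.+1) ->
    (forall j h v, v \in S (prevk j) h -> pr y j h *m v \in S (nextk j) h) ->
    nfr y \in S (firstk hk) 0%N ->
    forall j h, S j h = fullv.

Definition ndata_ideals (y : ndata) (J : 'I_k -> set {mpoly F[2]}) : Prop :=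
  exists q : forall j h, {linear {mpoly F[2]} -> 'cV[F]_(db j h)},
    [/\ forall j h f, whomog 1 h f -> (q j h f = 0 <-> J j f),
        forall j h v, exists2 f, whomog 1 h f & q j h f = v,
        forall j h f, whomog 1 h f ->
          q j h.+1 (px F * f) = C1 y j h *m q j h f /\
          q j h.+1 (py F * f) = C2 y j h *m q j h f,
        forall j h f, whomog 1 h f ->
          q (nextk j) h f = pr y j h *m q (prevk j) h f &
        q (firstk hk) 0%N 1 = nfr y].

Definition ndata_equiv (y y' : ndata) : Prop :=
  exists g : forall j h, 'M[F]_(db j h),
    [/\ forall j h, g j h \in unitmx,
        forall j h, C1 y' j h *m g j h = g j h.+1 *m C1 y j h,
        forall j h, C2 y' j h *m g j h = g j h.+1 *m C2 y j h,
        forall j h, pr y' j h *m g (prevk j) h = g (nextk j) h *m pr y j h &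
        nfr y' = g (firstk hk) 0%N *m nfr y].

Lemma ndata_ideals_fibre (y y' : ndata) J :
  ndata_ideals y J -> ndata_ideals y' J -> ndata_equiv y y'.
Proof.
move=> [q [e s q1 q2 q0]] [q' [e' s' q1' q2' q0']].
pose g j h := sval (quot_map_unique (s j h) (s' j h) (e j h) (e' j h)).
have Hg j h : g j h \in unitmx /\ forall f, whomog 1 h f -> q' j h f = g j h *m q j h f.
  exact: svalP (quot_map_unique (s j h) (s' j h) (e j h) (e' j h)).
exists g; split.
- by move=> j h; case: (Hg j h).
- move=> j h; apply: (ext_q (s j h)) => f hf.
  rewrite -!mulmxA -(q1 j h f hf).1 -(Hg j h).2 // -(q1' j h f hf).1 (Hg _ _).2 //.
  exact: whomog_px.
- move=> j h; apply: (ext_q (s j h)) => f hf.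
  rewrite -!mulmxA -(q1 j h f hf).2 -(Hg j h).2 // -(q1' j h f hf).2 (Hg _ _).2 //.
  by move: (whomog_py hf); rewrite addn1.
- move=> j h; apply: (ext_q (s _ h)) => f hf.
  by rewrite -!mulmxA -q2 // -(Hg _ h).2 // -q2' // (Hg _ _).2.
- by rewrite -q0 -q0' (Hg _ 0%N).2 //; exact: whomog_1.
Qed.

Lemma ndata_equiv_ideals (y y' : ndata) J :
  ndata_ideals y J -> ndata_equiv y y' -> ndata_ideals y' J.
Proof.
move=> [q [e s q1 q2 q0]] [g [gu g1 g2 g3 g0]].
exists (fun j h => mulmx (g j h) \o q j h); split => /=.
- move=> j h f hf; apply: iff_trans (e j h f hf); split; last by move->; rewrite mulmx0.
  by move/(congr1 (mulmx (invmx (g j h)))); rewrite mulKmx // mulmx0.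
- move=> j h v; have [f hf Hf] := s j h (invmx (g j h) *m v); exists f => //.
  by rewrite /= Hf mulKVmx.
- move=> j h f hf; rewrite (q1 j h f hf).1 (q1 j h f hf).2.
  by split; rewrite !mulmxA ?g1 ?g2.
- by move=> j h f hf; rewrite q2 // !mulmxA g3.
- by rewrite q0 -g0.
Qed.

Lemma ndata_ideals_surj J : nested_ideals db J -> exists y, ndata_ideals y J.
Proof.
move=> [hJ hsub hd].
have IM j f g : J j g -> J j (f * g) by case: (hJ j) => -[_ _ IM] _; exact: IM.
pose q j h := sval (quot_map (hJ j).1 (hd j h)).
have Hq j h := svalP (quot_map (hJ j).1 (hd j h)); rewrite -/(q _ _) in Hq.
have qi j h := (Hq j h).1; have qs j h := (Hq j h).2.
have whpy h f : whomog 1 h f -> whomog 1 h.+1 (py F * f).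
  by move=> /whomog_py; rewrite addn1.
have lx j h : linear (fun f : {mpoly F[2]} => q j h.+1 (px F * f)).
  by move=> c f g; rewrite mulrDr -scalerAr linearP.
have ly j h : linear (fun f : {mpoly F[2]} => q j h.+1 (py F * f)).
  by move=> c f g; rewrite mulrDr -scalerAr linearP.
have ex j h := quot_factor (lx j h) (qs j h) (fun f hf q0 =>
  (qi j h.+1 _ (whomog_px hf)).2 (IM _ _ _ ((qi j h f hf).1 q0))).
have ey j h := quot_factor (ly j h) (qs j h) (fun f hf q0 =>
  (qi j h.+1 _ (whpy _ _ hf)).2 (IM _ _ _ ((qi j h f hf).1 q0))).
have lt (j : 'I_k.-1) : (prevk j < nextk j)%N by [].
have ep j h := quot_factor (linearP (q (nextk j) h)) (qs (prevk j) h)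
  (fun f hf q0 => (qi (nextk j) h f hf).2 (hsub _ _ (lt j) _ ((qi _ h f hf).1 q0))).
exists (NData (fun j h => projT1 (cid (ex j h))) (fun j h => projT1 (cid (ey j h)))
  (fun j h => projT1 (cid (ep j h))) (q (firstk hk) 0%N 1)).
exists q; split=> //.
- by move=> j h f hf; split; [exact: (projT2 (cid (ex j h)))|exact: (projT2 (cid (ey j h)))].
- by move=> j h; exact: projT2 (cid (ep j h)).
Qed.

Definition nested_chart (y : ndata) (w : {J | nested_ideals db J}) : Prop :=
  [/\ ndata_rel y, ndata_stable y & ndata_ideals y (sval w)].

Definition nested_hilb : variety F := quotient_variety ndata_coord nested_chart.

End Nested.

(* The map [pi] on quiver data, [C1 = B1 ^ k], [C2 = B2], [p = B1]; the casts are
   along the identifications [V_(j, h) = V_(j + k * h)]. *)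
Section Pi.
Variables (F : fieldType) (k : nat) (hk : (1 <= k)%N).
Variables (d : nat -> nat) (db : 'I_k -> nat -> nat).
Hypothesis Hd : forall (j : 'I_k) h, d (j + k * h) = db j h.

Lemma Hd_pow (j : 'I_k) h : d (k + (j + k * h)) = db j h.+1.
Proof. by rewrite -Hd mulnS addnCA. Qed.

Lemma Hd_shift (j : 'I_k) h : d (j + k * h + k) = db j h.+1.
Proof. by rewrite addnC Hd_pow. Qed.

Lemma Hd_first : d 0 = db (firstk hk) 0.
Proof. by rewrite -Hd muln0. Qed.

Definition pi_data (x : data F k d) : ndata F hk db :=
  {| C1 := fun j h => castmx (Hd_pow j h, Hd j h) (B1pow x k (j + k * h));
     C2 := fun j h => castmx (Hd_shift j h, Hd j h) (B2 x (j + k * h));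
     pr := fun j h =>
       castmx (Hd (nextk j) h, Hd (prevk j) h) (B1 x (prevk j + k * h));
     nfr := castmx (Hd_first, erefl 1%N) (fr x) |}.

End Pi.

Definition sums_to (u : nat -> nat) (s : nat) : Prop :=
  exists N, (forall j, (N <= j)%N -> u j = 0%N) /\ (\sum_(j < N) u j = s)%N.

Definition eq_degrees (k : nat) (db : 'I_k -> nat -> nat) : set nat :=
  [set i | forall a b : 'I_k, db a i = db b i]%classic.

(* Main.v *)
(** Writing [f = \sum_(j < k) x^j f_j(x^k, y)], a quasi-homogeneous ideal [I]
    is the same thing as a chain [J_0 <= ... <= J_(k-1)] of homogeneous ideals
    with [x J_(k-1) <= J_0], namely [J_j = {f | x^j f(x^k, y) \in I}]; in terms of
    quiver data this is [pi].  The condition [x J_(k-1) <= J_0] is automatic: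
    among two consecutive degrees [h], [h + 1] at least one lies in [E], and there
    [J_0] and [J_(k-1)] agree.  In quiver terms the missing map
    [B_1 : V_(k,h) -> V_(1,h+1)] is [C_1 p^-1] or [p^-1 C_1], where [p] is the
    composite of the [p_j] in degree [h] or [h + 1]; its entries are rational
    functions without poles on the charted data, so the inverse of [pi] is also
    a morphism. *)
Require Import Defs.
From mathcomp Require Import all_boot all_order all_algebra.
From mathcomp Require Import mpoly.
From mathcomp Require Import boolp classical_sets reals complex.
From HB Require Import structures.
From mathcomp Require Import zify.

Set Implicit Arguments.
Unset Strict Implicit.
Unset Printing Implicit Defensive.

Import GRing.Theory.
Local Open Scope ring_scope.

(** * Rational functions and morphisms of quotients *)

Section Polyfun.
Variables (F : fieldType) (X : Type) (coord : (X -> F) -> Prop).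
Notation polyfun := (polyfun coord).

Lemma eq_polyfun f g : f =1 g -> polyfun f -> polyfun g.
Proof. by move=> /funext ->. Qed.

Lemma polyfun_sum (I : Type) (r : seq I) (p : pred I) (f : I -> X -> F) :
  (forall i, polyfun (f i)) -> polyfun (fun x => \sum_(i <- r | p i) f i x).
Proof.
move=> hf; elim: r => [|i r IH].
  by apply: eq_polyfun (polyfun_const _ 0) => x; rewrite big_nil.
have [pi|pi] := boolP (p i).
  by apply: eq_polyfun (polyfun_add (hf i) IH) => x; rewrite big_cons pi.
by apply: eq_polyfun IH => x; rewrite big_cons (negPf pi).
Qed.

Lemma polyfun_prod (I : Type) (r : seq I) (p : pred I) (f : I -> X -> F) :
  (forall i, polyfun (f i)) -> polyfun (fun x => \prod_(i <- r | p i) f i x).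
Proof.
move=> hf; elim: r => [|i r IH].
  by apply: eq_polyfun (polyfun_const _ 1) => x; rewrite big_nil.
have [pi|pi] := boolP (p i).
  by apply: eq_polyfun (polyfun_mul (hf i) IH) => x; rewrite big_cons pi.
by apply: eq_polyfun IH => x; rewrite big_cons (negPf pi).
Qed.

Definition polymx m n (A : X -> 'M[F]_(m, n)) :=
  forall i j, polyfun (fun x => A x i j).

Lemma polymx_mul m n p (A : X -> 'M[F]_(m, n)) (B : X -> 'M[F]_(n, p)) :
  polymx A -> polymx B -> polymx (fun x => A x *m B x).
Proof.
move=> hA hB i j; have h := polyfun_sum (index_enum 'I_n) xpredT
  (fun l => polyfun_mul (hA i l) (hB l j)).
by apply: eq_polyfun h => x; rewrite mxE.
Qed.

Lemma polymx_cast m n m' n' (e : (m = m') * (n = n')) (A : X -> 'M[F]_(m, n)) :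
  polymx A -> polymx (fun x => castmx e (A x)).
Proof.
move=> hA i j.
by apply: eq_polyfun (hA (cast_ord (esym e.1) i) (cast_ord (esym e.2) j)) => x;
  rewrite castmxE.
Qed.

Lemma polyfun_det n (A : X -> 'M[F]_n) : polymx A -> polyfun (fun x => \det (A x)).
Proof.
move=> hA; apply: polyfun_sum => s.
by apply: polyfun_mul; [exact: polyfun_const|exact: polyfun_prod].
Qed.

Lemma polymx_adj n (A : X -> 'M[F]_n) : polymx A -> polymx (fun x => \adj (A x)).
Proof.
move=> hA i j.
have h : polyfun (fun x => cofactor (A x) j i).
  apply: polyfun_mul; first exact: polyfun_const.
  apply: polyfun_det => a b.
  by apply: eq_polyfun (hA (lift j a) (lift i b)) => x; rewrite !mxE.
by apply: eq_polyfun h => x; rewrite mxE.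
Qed.

Variable dom : X -> Prop.

(** A single fraction serves the whole of [dom], with a denominator that has no zero there. Sums and
    products therefore stay in the class without shrinking the domain. *)
Definition ratfun (f : X -> F) :=
  exists a b, [/\ polyfun a, polyfun b &
    forall x, dom x -> b x != 0 /\ f x = a x / b x].

Lemma polyfun_ratfun f : polyfun f -> ratfun f.
Proof.
move=> hf; exists f, (fun=> 1); split=> //; first exact: polyfun_const.
by move=> x _; rewrite oner_neq0 divr1.
Qed.

Lemma eq_ratfun f g : (forall x, dom x -> f x = g x) -> ratfun f -> ratfun g.
Proof.
move=> fg [a [b [ha hb h]]]; exists a, b; split=> // x dx.
by rewrite -fg //; exact: h.
Qed.

Lemma ratfun_add f g : ratfun f -> ratfun g -> ratfun (fun x => f x + g x).
Proof.
move=> [a [b [ha hb h]]] [a' [b' [ha' hb' h']]].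
exists (fun x => a x * b' x + a' x * b x), (fun x => b x * b' x); split.
- by apply: polyfun_add; exact: polyfun_mul.
- exact: polyfun_mul.
- move=> x dx; have [b0 ->] := h x dx; have [b0' ->] := h' x dx.
  by rewrite mulf_neq0 // addf_div.
Qed.

Lemma ratfun_mul f g : ratfun f -> ratfun g -> ratfun (fun x => f x * g x).
Proof.
move=> [a [b [ha hb h]]] [a' [b' [ha' hb' h']]].
exists (fun x => a x * a' x), (fun x => b x * b' x); split; try exact: polyfun_mul.
move=> x dx; have [b0 ->] := h x dx; have [b0' ->] := h' x dx.
by rewrite mulf_neq0 // mulf_div.
Qed.

Lemma ratfun_sum (I : Type) (r : seq I) (f : I -> X -> F) :
  (forall i, ratfun (f i)) -> ratfun (fun x => \sum_(i <- r) f i x).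
Proof.
move=> hf; elim: r => [|i r IH].
  apply: (@eq_ratfun (fun=> 0)); first by move=> x _; rewrite big_nil.
  exact/polyfun_ratfun/polyfun_const.
by apply: eq_ratfun (ratfun_add (hf i) IH) => x _; rewrite big_cons.
Qed.

Definition ratmx m n (A : X -> 'M[F]_(m, n)) :=
  forall i j, ratfun (fun x => A x i j).

Lemma polymx_ratmx m n (A : X -> 'M[F]_(m, n)) : polymx A -> ratmx A.
Proof. by move=> hA i j; apply: polyfun_ratfun. Qed.

Lemma ratmx_mul m n p (A : X -> 'M[F]_(m, n)) (B : X -> 'M[F]_(n, p)) :
  ratmx A -> ratmx B -> ratmx (fun x => A x *m B x).
Proof.
move=> hA hB i j; have h := ratfun_sum (index_enum 'I_n)
  (fun l => ratfun_mul (hA i l) (hB l j)).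
by apply: eq_ratfun h => x _; rewrite mxE.
Qed.

Lemma ratmx_cast m n m' n' (e : (m = m') * (n = n')) (A : X -> 'M[F]_(m, n)) :
  ratmx A -> ratmx (fun x => castmx e (A x)).
Proof.
move=> hA i j.
by apply: eq_ratfun (hA (cast_ord (esym e.1) i) (cast_ord (esym e.2) j)) => x _;
  rewrite castmxE.
Qed.

End Polyfun.

(* The inverse of [A] when [m = n] and [A] is invertible; a junk value
   otherwise. *)
Definition rect_inv (F : fieldType) m n (A : 'M[F]_(m, n)) : 'M[F]_(n, m) :=
  conform_mx 0 (invmx (conform_mx (0 : 'M_n) A)).

Lemma rect_invK (F : fieldType) m n (A : 'M[F]_(m, n)) :
  m = n -> row_free A -> rect_inv A *m A = 1%:M.
Proof.
move=> e; subst m; rewrite /rect_inv !conform_mx_id row_free_unit.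
exact: mulVmx.
Qed.

(** Cramer's rule: adjugate over determinant. A square matrix with free rows has nonzero
    determinant, so the denominator is admissible on [dom]. *)
Lemma ratmx_rect_inv (F : fieldType) X coord (dom : X -> Prop) m n
    (A : X -> 'M[F]_(m, n)) :
  m = n -> polymx coord A -> (forall x, dom x -> row_free (A x)) ->
  ratmx coord dom (fun x => rect_inv (A x)).
Proof.
move=> e; subst m => hA uA i j.
exists (fun x => (\adj (A x)) i j), (fun x => \det (A x)); split.
- exact: polymx_adj.
- exact: polyfun_det.
- move=> x /uA; rewrite row_free_unit => u; split.
    by move: u; rewrite unitmxE unitfE.
  by rewrite /rect_inv !conform_mx_id /invmx u mxE mulrC.
Qed.

(** It suffices to lift [g] to a map [s] of representatives with rational coordinates: composing
    with [s] turns polynomials on [Y] into fractions on the charted part of [X], and these define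
    the open sets and the regular functions. *)
Lemma quotient_morphism (F : fieldType) X Z Y W
    (cX : (X -> F) -> Prop) (chX : X -> Z -> Prop)
    (cY : (Y -> F) -> Prop) (chY : Y -> W -> Prop) (g : Z -> W) (s : X -> Y) :
  (forall x z, chX x z -> chY (s x) (g z)) ->
  (forall c, cY c -> ratfun cX (fun x => exists z, chX x z) (c \o s)) ->
  is_morphism (X := quotient_variety cX chX) (Y := quotient_variety cY chY) g.
Proof.
move=> hs hc.
have hp b : polyfun cY b -> ratfun cX (fun x => exists z, chX x z) (b \o s).
  elim=> [c|c /hc //|f f' _ IH _ IH'|f f' _ IH _ IH'].
  - exact/polyfun_ratfun/polyfun_const.
  - exact: ratfun_add.
  - exact: ratfun_mul.
have dX x z : chX x z -> exists z, chX x z by exists z.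
(* Since [v] has no zero on charted points, the nonvanishing locus of [b \o s] is that of its
   numerator [u], a polynomial. *)
have nz (b : Y -> F) (u v : X -> F) x z :
    (forall x, (exists z, chX x z) -> v x != 0 /\ (b \o s) x = u x / v x) ->
    chX x z -> (b (s x) != 0) = (u x != 0).
  move=> uv /dX /uv[v0]; rewrite /= => ->.
  by rewrite mulf_eq0 invr_eq0 (negPf v0) orbF.
move=> V oV; split.
  move=> x z xz Vz; have [b [pb b0 hb]] := oV _ _ (hs x z xz) Vz.
  have [u [v [pu _ uv]]] := hp b pb.
  exists u; split=> // [|x' z' xz' u0]; first by rewrite -(nz _ _ _ _ _ uv xz).
  by apply: (hb _ _ (hs _ _ xz')); rewrite (nz _ _ _ _ _ uv xz').
move=> f rf x z xz Vz; have [a [b [pa pb b0 hab]]] := rf _ _ (hs x z xz) Vz.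
have [u [v [pu pv uv]]] := hp b pb; have [u' [v' [pu' pv' uv']]] := hp a pa.
(* The quotient of the two pullbacks [u' / v'] and [u / v], cleared of double fractions. *)
exists (fun x => u' x * v x), (fun x => v' x * u x); split; try exact: polyfun_mul.
  by rewrite mulf_neq0 -?(nz _ _ _ _ _ uv xz) // (uv' _ (dX _ _ xz)).1.
move=> x' z' xz' Vz'; rewrite mulf_eq0 negb_or => /andP[_ u0].
rewrite /= (hab _ _ (hs _ _ xz') Vz') ?(nz _ _ _ _ _ uv xz') //.
rewrite -[b _]/((b \o s) x') -[a _]/((a \o s) x').
by rewrite (uv x' (dX _ _ xz')).2 (uv' x' (dX _ _ xz')).2 invf_div mulf_div.
Qed.

(** * Decomposition of polynomials modulo x^k *)

Section Monomials.
Variable F : fieldType.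
Notation P := {mpoly F[2]}.
Notation px := (px F).
Notation py := (py F).

Lemma mpolyX2E (m : 'X_{1..2}) : 'X_[m] = px ^+ m ord0 * py ^+ m ord_max :> P.
Proof.
rewrite mpolyXE_id !big_ord_recl big_ord0 mulr1.
by have -> : lift ord0 ord0 = ord_max :> 'I_2 by apply/val_inj.
Qed.

Lemma pxyE a b : px ^+ a * py ^+ b = 'X_[(U_(ord0) *+ a + U_(ord_max) *+ b)%MM].
Proof.
rewrite mpolyX2E !(mnmDE, mulmnE, mnm1E) /=.
by rewrite !(mul1n, mul0n, muln1, muln0, addn0, add0n).
Qed.

(** Monomials span the polynomial ring; the operator identities below are reduced to exponent
    arithmetic in this way. *)
Lemma eq_linear_pxy (V : lmodType F) (u v : {linear P -> V}) :
  (forall a b, u (px ^+ a * py ^+ b) = v (px ^+ a * py ^+ b)) -> u =1 v.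
Proof.
move=> uv f; rewrite [f]mpolyE !linear_sum; apply: eq_bigr => m _.
by rewrite /= !linearZ mpolyX2E uv.
Qed.

HB.instance Definition _ k j :=
  GRing.isLinear.Build F P P _ (@wcomp F k j) (@wcomp_lin F k j).

Lemma wcomp_pxy k i a b : wcomp k i (px ^+ a * py ^+ b) =
  if (a + k * b == i)%N then px ^+ a * py ^+ b else 0.
Proof.
rewrite pxyE /wcomp msuppX big_mkcond big_seq1 mcoeffX eqxx scale1r.
by rewrite /wdeg !(mnmDE, mulmnE, mnm1E) /= !(mul1n, mul0n, muln1, muln0, addn0, add0n).
Qed.

Lemma wcomp_wcomp k i j (f : P) :
  wcomp k i (wcomp k j f) = if j == i then wcomp k j f else 0.
Proof.
(* Writing the conditional as a scalar multiple makes the right side a linear map, as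
   [eq_linear_pxy] requires. *)
transitivity ((j == i)%:R *: wcomp k j f); last first.
  by case: ifP; rewrite ?scale1r ?scale0r.
move: f; apply: (eq_linear_pxy (u := wcomp k i \o wcomp k j)
  (v := *:%R _ \o wcomp k j)) => a b /=.
rewrite wcomp_pxy; case: eqVneq => [<-|_]; last by rewrite !linear0.
by rewrite wcomp_pxy; case: ifP; rewrite ?scale1r ?scale0r.
Qed.

Lemma wcomp_px k i (f : P) : wcomp k i.+1 (px * f) = px * wcomp k i f.
Proof.
move: f; apply: (eq_linear_pxy (u := wcomp k i.+1 \o (px \*o idfun))
  (v := (px \*o idfun) \o wcomp k i)) => a b /=.
rewrite mulrA -exprS !wcomp_pxy addSn eqSS; case: ifP; rewrite ?mulr0 //.
by rewrite mulrA -exprS.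
Qed.

Lemma wcomp_px0 k (f : P) : wcomp k 0 (px * f) = 0.
Proof.
move: f; apply: (eq_linear_pxy (u := wcomp k 0 \o (px \*o idfun)) (v := \0)) => a b /=.
by rewrite mulrA -exprS wcomp_pxy.
Qed.

Lemma whomog_pxy k a b : whomog k (a + k * b) (px ^+ a * py ^+ b).
Proof. by have := @wcomp_homog F k (a + k * b) (px ^+ a * py ^+ b); rewrite wcomp_pxy eqxx. Qed.

Lemma memv_whomog k i n (q : {linear P -> 'cV[F]_n}) (S : {vspace 'cV[F]_n}) :
  (forall a b, (a + k * b)%N = i -> q (px ^+ a * py ^+ b) \in S) ->
  forall f, whomog k i f -> q f \in S.
Proof.
move=> qS f hf; rewrite [f]mpolyE linear_sum big_seq; apply: memv_suml => m /hf hm.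
by rewrite linearZ memvZ // mpolyX2E qS.
Qed.

Lemma wcomp_sum k (f : P) : exists N, f = \sum_(i < N) wcomp k i f.
Proof.
pose N := (\max_(m <- msupp f) (wdeg k m).+1)%N; exists N.
rewrite {1}[f]mpolyE /wcomp (exchange_big_dep xpredT) //= !big_seq; apply: eq_bigr => m hm.
have lt : (wdeg k m < N)%N by rewrite /N (big_rem m) //= leq_maxl.
by rewrite (big_pred1 (Ordinal lt)) // => i; rewrite -val_eqE eq_sym.
Qed.

Lemma ideal_wcomp k (I : set P) f :
  is_ideal I -> (forall i, I (wcomp k i f)) -> I f.
Proof.
move=> [I0 ID _] h; have [N ->] := wcomp_sum k f.
by elim/big_ind: _.
Qed.

(** Lifts of the standard basis along [q] form a basis of the quotient, in which [f] has coordinate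
    vector [q f]. *)
Lemma quot_dimP (S I : set P) n (q : {linear P -> 'cV[F]_n}) :
  S 0 -> (forall c f g, S f -> S g -> S (c *: f + g)) ->
  (forall v, exists2 f, S f & q f = v) ->
  (forall f, S f -> (q f = 0 <-> I f)) -> quot_dim S I n.
Proof.
move=> S0 SD qs qi.
have [a|e he] := @boolp.choice _ _ (fun a f => S f /\ q f = delta_mx a 0).
  by have [f] := qs (delta_mx a 0); exists f.
exists e; split=> [a|f Sf]; first by case: (he a).
have SS (c : 'cV[F]_n) : S (\sum_(a < n) c a 0 *: e a).
  by elim/big_rec: _ => // a g _ Sg; apply: SD => //; case: (he a).
have qS (c : 'cV[F]_n) : q (f - \sum_(a < n) c a 0 *: e a) = q f - c.
  rewrite linearB linear_sum /=; congr (_ - _).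
  rewrite [RHS]matrix_sum_delta; apply: eq_bigr => a _.
  by rewrite linearZ /= (he a).2 big_ord1.
have Sc c : S (f - \sum_(a < n) (c : 'cV[F]_n) a 0 *: e a).
  by rewrite addrC -scaleN1r; apply: SD.
exists (q f); split; first by rewrite /= -qi // qS subrr.
by move=> c; rewrite -qi // qS => /eqP; rewrite subr_eq0 => /eqP.
Qed.
End Monomials.

Section Decomposition.
Variables (F : fieldType) (k : nat).
Notation P := {mpoly F[2]}.
Notation px := (px F).
Notation py := (py F).

(** The substitution f(x^k, y). For k >= 1 the polynomial ring is free over its image with basis 1,
    x, ..., x^(k-1). *)
Definition frob : P -> P := comp_mpoly [tuple px ^+ k; py].
HB.instance Definition _ := GRing.RMorphism.on frob.
HB.instance Definition _ := GRing.Linear.on frob.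

Lemma frob_px : frob px = px ^+ k.
Proof. by rewrite /frob comp_mpolyXU. Qed.
Lemma frob_py : frob py = py.
Proof. by rewrite /frob comp_mpolyXU. Qed.

Hypothesis hk : (1 <= k)%N.

Definition emb j (f : P) : P := px ^+ j * frob f.

Lemma emb_linear j : linear (emb j).
Proof. by move=> c f g; rewrite /emb linearP mulrDr scalerAr. Qed.
HB.instance Definition _ j := GRing.isLinear.Build F P P _ (emb j) (emb_linear j).

(* The component [f_j] of [f]; [emb j] puts it back in place. *)
Definition dec j (f : P) : P := \sum_(m <- msupp f | (m ord0 %% k == j)%N)
  f@_m *: (px ^+ (m ord0 %/ k)%N * py ^+ m ord_max).

Lemma dec_linear j : linear (dec j).
Proof.
(* The support varies with [f]; summing over one list containing all the supports involved makes
   linearity a termwise check. *)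
have decE (f : P) (e : seq 'X_{1..2}) : uniq e -> {subset msupp f <= e} ->
    dec j f = \sum_(m <- e | (m ord0 %% k == j)%N)
      f@_m *: (px ^+ (m ord0 %/ k)%N * py ^+ m ord_max).
  move=> ue se; rewrite /dec [RHS](bigID (mem (msupp f))) /= [X in _ + X]big1 ?addr0; last first.
    by move=> m /andP[_ /memN_msupp_eq0 ->]; rewrite scale0r.
  rewrite -big_filter -[RHS]big_filter; apply/perm_big/uniq_perm.
  - by rewrite filter_uniq ?msupp_uniq.
  - by rewrite filter_uniq.
  - move=> m; rewrite !mem_filter /=.
    by case: (m \in msupp f) (se m) => [/(_ isT) ->|]; rewrite ?andbT ?andbF.
move=> c f g; pose e := undup (msupp f ++ msupp g ++ msupp (c *: f + g)).
have ue : uniq e by exact: undup_uniq.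
rewrite !(decE _ e) //; try by move=> m; rewrite mem_undup !mem_cat => ->; rewrite ?orbT.
rewrite scaler_sumr -big_split /=; apply: eq_bigr => m _.
by rewrite mcoeffD mcoeffZ scalerDl scalerA.
Qed.
HB.instance Definition _ j := GRing.isLinear.Build F P P _ (dec j) (dec_linear j).

Lemma dec_pxy i j a b : (i < k)%N -> dec j (px ^+ (i + k * a) * py ^+ b) =
  if (i == j)%N then px ^+ a * py ^+ b else 0.
Proof.
move=> ik; rewrite pxyE /dec msuppX big_mkcond big_seq1 mcoeffX eqxx scale1r.
rewrite !(mnmDE, mulmnE, mnm1E) /= !(mul1n, mul0n, muln1, muln0, addn0, add0n).
by rewrite addnC mulnC modnMDl divnMDl // modn_small // divn_small // addn0.
Qed.

Lemma emb_pxy j a b : emb j (px ^+ a * py ^+ b) = px ^+ (j + k * a) * py ^+ b.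
Proof. by rewrite /emb rmorphM !rmorphXn /= frob_px frob_py -exprM mulrA -exprD. Qed.

Lemma emb_px j f : emb j (px * f) = px ^+ k * emb j f.
Proof. by rewrite /emb rmorphM /= frob_px mulrCA. Qed.

Lemma emb_py j f : emb j (py * f) = py * emb j f.
Proof. by rewrite /emb rmorphM /= frob_py mulrCA. Qed.

Lemma emb_mul j f g : emb j (f * g) = frob f * emb j g.
Proof. by rewrite /emb rmorphM mulrCA. Qed.

Lemma embS j f : emb j.+1 f = px * emb j f.
Proof. by rewrite /emb exprS mulrA. Qed.

Lemma eq_linear_dec (V : lmodType F) (u v : {linear P -> V}) :
  (forall i a b, (i < k)%N ->
    u (px ^+ (i + k * a) * py ^+ b) = v (px ^+ (i + k * a) * py ^+ b)) -> u =1 v.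
Proof.
move=> uv; apply: eq_linear_pxy => a b.
by rewrite (divn_eq a k) addnC mulnC; apply: uv; rewrite ltn_mod.
Qed.

Lemma dec_emb i j f : (i < k)%N -> (j < k)%N ->
  dec i (emb j f) = if i == j then f else 0.
Proof.
move=> ik jk; transitivity ((i == j)%:R *: f); last by case: ifP; rewrite ?scale1r ?scale0r.
move: f; apply: (eq_linear_pxy (u := dec i \o emb j) (v := *:%R _)) => a b.
by rewrite /= emb_pxy dec_pxy // eq_sym; case: ifP; rewrite ?scale1r ?scale0r.
Qed.

Lemma dec_px j f : (j.+1 < k)%N -> dec j.+1 (px * f) = dec j f.
Proof.
move=> jk; move: f; apply: (eq_linear_dec (u := dec j.+1 \o (px \*o idfun))) => i a b ik /=.
rewrite mulrA -exprS dec_pxy // -addSn.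
have [ik'|ik'] := ltnP i.+1 k; first by rewrite dec_pxy.
(* Here [i = k - 1], so multiplication by x wraps around to residue 0 and contributes nothing to
   component [j.+1]. *)
have -> : (i.+1 + k * a = 0 + k * a.+1)%N by rewrite mulnS; lia.
by rewrite dec_pxy //; have -> : (i == j) = false by lia.
Qed.

(** Multiplication by x shifts the components cyclically. On wrapping around, x * x^(k-1) = x^k is
    the image of x under [frob], hence the extra factor x. *)
Lemma dec_px_last f : dec 0 (px * f) = px * dec k.-1 f.
Proof.
move: f; apply: (eq_linear_dec (u := dec 0 \o (px \*o idfun))
  (v := (px \*o idfun) \o dec k.-1)) => i a b ik /=.
rewrite mulrA -exprS dec_pxy // -addSn.
have [ik'|ik'] := ltnP i.+1 k.
  have -> : (i == k.-1) = false by lia.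
  by rewrite dec_pxy //= mulr0.
have -> : (i.+1 + k * a = 0 + k * a.+1)%N by rewrite mulnS; lia.
have -> : (i == k.-1) by lia.
by rewrite dec_pxy // mulrA -exprS.
Qed.

Lemma dec_py j f : dec j (py * f) = py * dec j f.
Proof.
move: f; apply: (eq_linear_dec (u := dec j \o (py \*o idfun))
  (v := (py \*o idfun) \o dec j)) => i a b ik /=.
rewrite mulrCA -exprS !dec_pxy //.
by case: ifP; rewrite ?mulr0 // mulrCA exprS.
Qed.

Lemma dec1 : dec 0 1 = 1.
Proof. by have := @dec_pxy 0 0 0 0 hk; rewrite muln0 !expr0 mulr1. Qed.

Lemma sum_emb_dec f : \sum_(j < k) emb j (dec j f) = f.
Proof.
pose u f := \sum_(j < k) emb j (dec j f).
have ul : linear u.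
  move=> c g h; rewrite /u scaler_sumr -big_split; apply: eq_bigr => j _.
  by rewrite !linearP.
pose L := GRing.isLinear.Build _ _ _ _ u ul.
pose u' : {linear P -> P} := HB.pack u L.
move: f; apply: (eq_linear_dec (u := u') (v := idfun)) => i a b ik /=.
rewrite /u (bigD1 (Ordinal ik)) //= dec_pxy // eqxx emb_pxy big1 ?addr0 // => j.
by rewrite -val_eqE /= => ij; rewrite dec_pxy // eq_sym (negPf ij) linear0.
Qed.

Lemma eqn_decomp i j a b : (i < k)%N -> (j < k)%N ->
  (i + k * a == j + k * b)%N = (i == j) && (a == b).
Proof.
move=> ik jk; apply/eqP/andP => [e|[/eqP -> /eqP ->] //].
have := congr1 (modn^~ k) e; have := congr1 (divn^~ k) e.
rewrite /= ![(_ + k * _)%N]addnC ![(k * _)%N]mulnC !modnMDl !divnMDl //.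
by rewrite !modn_small // !divn_small // !addn0 => -> ->.
Qed.

(** The monomial x^(l + k a) y^b with l < k has weight l + k (a + b), so residue and quotient of the
    weight modulo k are the index of its component and the standard degree of x^a y^b. *)
Lemma dec_wcomp i j h f : (i < k)%N -> (j < k)%N ->
  dec i (wcomp k (j + k * h) f) = if i == j then wcomp 1 h (dec j f) else 0.
Proof.
move=> ik jk; transitivity ((i == j)%:R *: wcomp 1 h (dec j f)); last first.
  by case: ifP; rewrite ?scale1r ?scale0r.
move: f; apply: (eq_linear_dec (u := dec i \o wcomp k _)
  (v := *:%R _ \o (wcomp 1 h \o dec j))) => l a b lk /=.
rewrite wcomp_pxy dec_pxy // -addnA -mulnDr eqn_decomp //.
have [->|lj] := eqVneq l j; last by rewrite /= !linear0.
rewrite wcomp_pxy mul1n /=; case: ifP => _; rewrite ?linear0 //.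
by rewrite dec_pxy // eq_sym; case: ifP; rewrite ?scale1r ?scale0r.
Qed.

Lemma emb_wcomp j h f : (j < k)%N ->
  emb j (wcomp 1 h f) = wcomp k (j + k * h) (emb j f).
Proof.
move=> jk; move: f.
apply: (eq_linear_pxy (u := emb j \o wcomp 1 h) (v := wcomp k _ \o emb j)) => a b /=.
rewrite emb_pxy !wcomp_pxy -addnA -mulnDr eqn_decomp // eqxx mul1n /=.
by case: ifP => _; rewrite ?linear0 // emb_pxy.
Qed.

Lemma whomog_dec j h f : (j < k)%N -> whomog k (j + k * h) f -> whomog 1 h (dec j f).
Proof.
move=> jk /wcomp_id <-; rewrite dec_wcomp // eqxx; exact: wcomp_homog.
Qed.

Lemma whomog_emb j h f : (j < k)%N -> whomog 1 h f -> whomog k (j + k * h) (emb j f).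
Proof. move=> jk /wcomp_id <-; rewrite emb_wcomp //; exact: wcomp_homog. Qed.

Lemma emb_dec j h f : (j < k)%N -> whomog k (j + k * h) f -> emb j (dec j f) = f.
Proof.
move=> jk hf; rewrite -[RHS]sum_emb_dec -[f in RHS](wcomp_id hf).
rewrite (bigD1 (Ordinal jk)) //= dec_wcomp // eqxx big1 ?addr0 => [|i].
  by rewrite -[in LHS](wcomp_id hf) dec_wcomp // eqxx.
by rewrite -val_eqE /= => /negPf ij; rewrite dec_wcomp // ij linear0.
Qed.

Lemma wcomp_emb_dec i j h f : (i < k)%N -> (j < k)%N ->
  wcomp k (i + k * h) (emb j (dec j f)) = if i == j then wcomp k (i + k * h) f else 0.
Proof.
move=> ik jk; transitivity ((i == j)%:R *: wcomp k (i + k * h) f); last first.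
  by case: ifP; rewrite ?scale1r ?scale0r.
move: f; apply: (eq_linear_dec (u := wcomp k (i + k * h) \o (emb j \o dec j))
  (v := *:%R _ \o wcomp k (i + k * h))) => l a b lk /=.
rewrite dec_pxy // wcomp_pxy -addnA -mulnDr eqn_decomp //.
have [->|lj] := eqVneq l j.
  rewrite emb_pxy wcomp_pxy -addnA -mulnDr eqn_decomp // eq_sym.
  by have [->|_] := eqVneq j i; rewrite ?eqxx ?scale1r ?scale0r.
rewrite !linear0; have [il|_] := eqVneq l i; last by rewrite scaler0.
by rewrite -il (negPf lj) scale0r.
Qed.

End Decomposition.

(** * Quiver data and ideals *)

Section Correspondence.
Variable F : fieldType.
Notation P := {mpoly F[2]}.
Notation px := (px F).
Notation py := (py F).

(** Each monomial is built from 1 by multiplications by x and then by y. This is the generation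
    argument behind stability, with [k] arbitrary or equal to 1 in the two quiver descriptions. *)
Lemma memv_pxy k n (S : forall j, {vspace 'cV[F]_(n j)})
    (q : forall j, P -> 'cV[F]_(n j)) :
  q 0%N 1 \in S 0%N ->
  (forall j f, whomog k j f -> q j f \in S j -> q j.+1 (px * f) \in S j.+1) ->
  (forall j f, whomog k j f -> q j f \in S j ->
    q (j + k)%N (py * f) \in S (j + k)%N) ->
  forall j a b, (a + k * b)%N = j -> q j (px ^+ a * py ^+ b) \in S j.
Proof.
move=> S1 Sx Sy j a b <-; elim: b => [|b IH].
  rewrite muln0 addn0 mulr1; elim: a => [|a IH] //.
  rewrite exprS; apply: Sx => //.
  by have := @whomog_pxy F k a 0; rewrite muln0 addn0 mulr1.
rewrite mulnSr addnA exprS mulrCA; apply: Sy => //; exact: whomog_pxy.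
Qed.

Lemma whomog_py1 h (f : P) : whomog 1 h f -> whomog 1 h.+1 (py * f).
Proof. by move=> /whomog_py; rewrite addn1. Qed.

(** The relation is x y = y x, transported through the surjections [q j]. *)
Lemma data_ideal_rel k d (x : data F k d) I : data_ideal x I -> data_rel x.
Proof.
move=> [q [_ s q1 q2 _]] j; apply: (ext_q (s j)) => f hf.
rewrite -!mulmxA -(q1 _ _ hf) -(q2 _ _ hf) -(q1 _ _ (whomog_py hf)).
by rewrite -(q2 _ _ (whomog_px hf)) mulrCA.
Qed.

(** The classes of monomials span every [V_j], and all of them are reached from the class of 1. *)
Lemma data_ideal_stable k d (x : data F k d) I : data_ideal x I -> data_stable x.
Proof.
move=> [q [_ s q1 q2 q0]] S S1 S2 S0 j.
apply/vspaceP => v; rewrite memvf; have [f hf <-] := s j v.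
apply: memv_whomog hf => a b; apply: (memv_pxy (n := d) (S := S) (q := q)).
- by rewrite q0.
- by move=> i g hg Sg; rewrite q1 //; exact: S1.
- by move=> i g hg Sg; rewrite q2 //; exact: S2.
Qed.

Section Nested.
Variables (k : nat) (hk : (1 <= k)%N) (db : 'I_k -> nat -> nat).

Lemma ndata_ideals_rel (y : ndata F hk db) J : ndata_ideals y J -> ndata_rel y.
Proof.
move=> [q [_ s q1 q2 _]]; have q1l j h f hf := (q1 j h f hf).1.
have q1r j h f hf := (q1 j h f hf).2.
split=> j h; apply: (ext_q (s _ _)) => f hf; rewrite -!mulmxA.
- rewrite -(q1l _ _ _ hf) -(q1r _ _ _ hf) -(q1l _ _ _ (whomog_py1 hf)).
  by rewrite -(q1r _ _ _ (whomog_px hf)) mulrCA.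
- by rewrite -(q1l _ _ _ hf) -!q2 //; [rewrite q1l|exact: whomog_px].
- by rewrite -(q1r _ _ _ hf) -!q2 //; [rewrite q1r|exact: whomog_py1].
Qed.

Lemma ndata_ideals_stable (y : ndata F hk db) J : ndata_ideals y J -> ndata_stable y.
Proof.
move=> [q [_ s q1 q2 q0]] S S1 S2 Sp S0.
suff qS m (j : 'I_k) h f : nat_of_ord j = m -> whomog 1 h f -> q j h f \in S j h.
  move=> j h; apply/vspaceP => v; rewrite memvf; have [f hf <-] := s j h v.
  exact: (qS j).
(* The spaces with [j = 0] are generated from the framing by [C1] and [C2]; each later one is the
   image under [pr] of the previous one. *)
elim: m j f => [|m IH] j f jm.
  have -> : j = firstk hk by apply/val_inj.
  apply: memv_whomog => a b.
  apply: (memv_pxy (n := db _) (S := S _) (q := fun i : nat => q (firstk hk) i)).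
  - by rewrite q0.
  - by move=> i g hg Sg; rewrite (q1 _ _ _ hg).1; exact: S1.
  - move=> i g hg Sg; rewrite addn1 (q1 _ _ _ hg).2; exact: S2.
have lt : (m < k.-1)%N by have := ltn_ord j; lia.
have -> : j = nextk (Ordinal lt) by apply/val_inj.
by move=> hf; rewrite q2 //; apply/Sp/IH.
Qed.
End Nested.

End Correspondence.

(** * Indices split into residue and quotient modulo [k], and the resulting casts *)

Section Reindex.
Variables (k : nat) (hk : (1 <= k)%N) (T : nat -> Type).
Variable t : forall (j : 'I_k) h, T (j + k * h)%N.

Lemma decomp_subproof i : (i %% k < k)%N.
Proof. by rewrite ltn_mod. Qed.

Lemma decompE i : (Ordinal (decomp_subproof i) + k * (i %/ k) = i)%N.
Proof. by rewrite /= addnC mulnC -divn_eq. Qed.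

(** The family is dependent, so the value at [i] has to be transported along [decompE]; at an index
    of the form [j + k * h] the transport disappears by uniqueness of equality proofs on [nat]. *)
Definition interleave i : T i :=
  eq_rect _ T (t (Ordinal (decomp_subproof i)) (i %/ k)) i (decompE i).

Lemma interleaveE (j : 'I_k) h : interleave (j + k * h)%N = t j h.
Proof.
rewrite /interleave; move: (decompE _).
have -> : Ordinal (decomp_subproof (j + k * h)%N) = j.
  by apply/val_inj; rewrite /= addnC mulnC modnMDl modn_small.
have -> : ((j + k * h) %/ k = h)%N.
  by rewrite addnC mulnC divnMDl // divn_small // addn0.
by move=> e; rewrite (eq_irrelevance e erefl).
Qed.
End Reindex.

Lemma nat_decomp_ind k (hk : (1 <= k)%N) (p : nat -> Prop) :
  (forall (j : 'I_k) h, p (j + k * h)%N) -> forall i, p i.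
Proof. by move=> h i; rewrite -(decompE hk i). Qed.

Section Casts.
Variables (F : fieldType) (d : nat -> nat).

Lemma castmx_colE V (q : forall i, V -> 'cV[F]_(d i)) i i' (e : d i = d i') f :
  i = i' -> castmx (e, erefl 1%N) (q i f) = q i' f.
Proof. by move=> ii'; subst i'; rewrite castmx_id. Qed.

Lemma mulmx_castl m m' n p (e : m = m') (e' : n = n) (A : 'M[F]_(m, n))
    (B : 'M[F]_(n, p)) : castmx (e, e') A *m B = castmx (e, erefl p) (A *m B).
Proof. by subst m'; rewrite !castmx_id. Qed.
End Casts.

(** * Passage between quasi-homogeneous ideals and chains of homogeneous ideals *)

Section IdealMaps.
Variables (F : fieldType) (k : nat).
Hypothesis hk : (1 <= k)%N.
Notation P := {mpoly F[2]}.
Notation px := (px F).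
Notation py := (py F).

Definition to_nested (I : set P) : 'I_k -> set P := fun j f => I (emb k j f).

Definition to_hilb (J : 'I_k -> set P) : set P := fun f => forall j, J j (dec k j f).

(** An ideal containing every [emb k j (dec k j f)] contains their sum [f]. Conversely, the weight
    components of these summands are zero or weight components of [f], so quasi-homogeneity puts
    them in [I]. *)
Lemma to_nestedK I : is_whomog_ideal k I -> to_hilb (to_nested I) = I.
Proof.
move=> [Ii Ih]; apply/funext => f; apply/propext; split=> [h|If j].
  rewrite -(sum_emb_dec hk f); have [I0 ID _] := Ii; elim/big_ind: _ => // j _.
  exact: h.
apply: (ideal_wcomp (k := k) Ii); apply: (nat_decomp_ind hk) => i h.
rewrite wcomp_emb_dec //; case: ifP => _; [exact: Ih|by case: Ii].
Qed.

Lemma to_hilbK J : (forall j, is_ideal (J j)) -> to_nested (to_hilb J) = J.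
Proof.
move=> Ji; apply/funext => j; apply/funext => f; apply/propext; split=> [/(_ j)|Jf i].
  by rewrite dec_emb // eqxx.
rewrite dec_emb // val_eqE; case: eqVneq => [->//|_]; by case: (Ji i).
Qed.

Lemma is_whomog_to_nested I j : is_whomog_ideal k I -> is_whomog_ideal 1 (to_nested I j).
Proof.
move=> [[I0 ID IM] Ih]; split; last first.
  by move=> f h If; rewrite /to_nested emb_wcomp //; exact: Ih.
split=> [|f g If Ig|f g Ig]; rewrite /to_nested.
- by rewrite linear0.
- by rewrite linearD; exact: ID.
- by rewrite emb_mul; exact: IM.
Qed.

Lemma to_nested_sub I (i j : 'I_k) : is_ideal I -> (i <= j)%N ->
  (to_nested I i `<=` to_nested I j)%classic.
Proof.
move=> [_ _ IM] ij f; rewrite /to_nested /emb -(subnK ij) exprD -mulrA.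
exact: IM.
Qed.

(** Stability under x and y is enough. Multiplication by x moves component [j] to [j + 1], which
    uses the chain condition, and the last component to component 0 with a factor x, which uses the
    third hypothesis. *)
Lemma is_whomog_to_hilb J :
  (forall j, is_whomog_ideal 1 (J j)) ->
  (forall i j : 'I_k, (i < j)%N -> (J i `<=` J j)%classic) ->
  (forall f (i j : 'I_k), i = 0%N :> nat -> j = k.-1 :> nat -> J j f -> J i (px * f)) ->
  is_whomog_ideal k (to_hilb J).
Proof.
move=> hJ sJ xJ.
have J0 j : J j 0 by case: (hJ j) => -[].
have JD j f g : J j f -> J j g -> J j (f + g) by case: (hJ j) => -[_ JD _] _; exact: JD.
have JM j f g : J j g -> J j (f * g) by case: (hJ j) => -[_ _ JM] _; exact: JM.
have Jx f : to_hilb J f -> to_hilb J (px * f).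
  move=> Jf j; case: j (ltn_ord j) => -[|m] lt _.
    rewrite dec_px_last //.
    have lt' : (k.-1 < k)%N by rewrite prednK.
    exact: (xJ _ _ (Ordinal lt')).
  have lt' : (m < k)%N by exact: ltnW.
  rewrite /= dec_px //; exact: (sJ (Ordinal lt')).
have Jy f : to_hilb J f -> to_hilb J (py * f).
  by move=> Jf j; rewrite dec_py //; exact: JM.
split; last first.
  move=> f; apply: (nat_decomp_ind hk) => i h Jf j.
  rewrite dec_wcomp // val_eqE; case: eqVneq => [->|_]; last exact: J0.
  by case: (hJ i) => _; apply.
split=> [j|f g Jf Jg j|f g Jg]; rewrite ?linear0 ?linearD //.
  exact: JD.
(* The multiplier is expanded into monomials, followed by induction on both exponents. *)
rewrite [f]mpolyE mulr_suml => l; rewrite linear_sum.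
elim/big_ind: _ => // [u v|m _]; first exact: JD.
rewrite -scalerAl linearZ /= -mul_mpolyC; apply: JM; move: l.
rewrite mpolyX2E -mulrA; elim: (m ord0) => [|a IH]; last first.
  by rewrite exprS -mulrA; exact: Jx.
rewrite mul1r; elim: (m ord_max) => [|b IH]; first by rewrite mul1r.
by rewrite exprS -mulrA; exact: Jy.
Qed.
End IdealMaps.

(** * Colength from the dimensions of the graded pieces *)

Section HilbIdeal.
Variables (F : fieldType) (k : nat) (d : nat -> nat).
Notation P := {mpoly F[2]}.

(** The quotient maps of degrees below [N] are stacked into one map onto a space of dimension [n];
    beyond [N] the graded pieces vanish. *)
Lemma data_ideal_hilb n (x : data F k d) I :
  is_whomog_ideal k I -> data_ideal x I -> sums_to d n -> hilb_ideal k n d I.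
Proof.
move=> hI [q [qi qs _ _ _]] [N [d0 <-]]; have [Ii Ih] := hI; split=> //; last first.
  move=> j; apply: (quot_dimP (q := q j)); [exact: whomog0| |exact: qs|exact: qi].
  by move=> c f g; exact: whomog_lin.
pose Q (f : P) : 'cV[F]_(\sum_(j < N) d j) := \mxcol_(j < N) q j (wcomp k j f).
have Ql : linear Q.
  by move=> c f g; apply/matrixP => i z; rewrite !mxE !linearP !mxE.
pose L := GRing.isLinear.Build _ _ _ _ Q Ql.
pose Q' : {linear P -> 'cV[F]_(\sum_(j < N) d j)} := HB.pack Q L.
apply: (quot_dimP (q := Q')) => //.
- move=> v.
  have [f hf] : exists f : 'I_N -> P, forall j : 'I_N,
      whomog k j (f j) /\ q j (f j) = submxcol v j.
    have [j|f hf] := @boolp.choice _ _ (fun (j : 'I_N) f =>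
      whomog k j f /\ q j f = submxcol v j); last by exists f.
    by have [f] := qs j (submxcol v j); exists f.
  exists (\sum_j f j) => //.
  apply/mxcolP => l; rewrite mxcolK; have [hl <-] := hf l; congr (q l _).
  rewrite (linear_sum (@wcomp F k l)) /= (bigD1 l) //= (wcomp_id hl).
  rewrite [X in _ + X]big1 ?addr0 // => i il.
  by rewrite -(wcomp_id (hf i).1) wcomp_wcomp val_eqE (negPf il).
- move=> f _; split=> [Qf|If].
    apply: (ideal_wcomp (k := k) Ii) => i; apply/qi; first exact: wcomp_homog.
    have [iN|/d0 di] := ltnP i N.
      have := congr1 (fun v => submxcol v (Ordinal iN)) Qf.
      by rewrite /= mxcolK submxcol0.
    (* In degrees at least [N] the target has dimension 0, so [q i] is zero there. *)
    by apply/matrixP => a; have := ltn_ord a; rewrite {2}di.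
  apply/mxcolP => l; rewrite mxcolK submxcol0; apply/qi; last exact: Ih.
  exact: wcomp_homog.
Qed.

Lemma sums_to_interleave (hk : (1 <= k)%N) (nb : 'I_k -> nat) :
  (forall j : 'I_k, sums_to (fun h => d (j + k * h)%N) (nb j)) ->
  sums_to d (\sum_(j < k) nb j)%N.
Proof.
move=> h; have [N hN] := @boolp.choice _ _ (fun (j : 'I_k) N =>
  (forall h, (N <= h)%N -> d (j + k * h) = 0)%N /\
  (\sum_(h < N) d (j + k * h) = nb j)%N) h.
(* A common bound for all residues, so that the double sum becomes a rectangle and then [M] blocks
   of [k] consecutive indices. *)
pose M := (\max_(j < k) N j)%N.
have hM (j : 'I_k) : (N j <= M)%N by exact: leq_bigmax.
exists (k * M)%N; split.
  apply: (nat_decomp_ind hk) => j i le; apply: (hN j).1; apply: leq_trans (hM j) _.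
  have := ltn_ord j; nia.
have -> : (\sum_(j < k) nb j = \sum_(j < k) \sum_(h < M) d (j + k * h))%N.
  apply: eq_bigr => j _; rewrite -(hN j).2 -!(big_mkord xpredT (fun h => d (j + k * h)%N)).
  rewrite (@big_cat_nat _ _ _ (N j) 0 M) //= [X in (_ = _ + X)%N]big_nat
    [X in (_ = _ + X)%N]big1 ?addn0 //.
  by move=> i /andP[/(hN j).1].
rewrite exchange_big /=; elim: M {hM} => [|M IH]; first by rewrite muln0 !big_ord0.
rewrite big_ord_recr /= -IH mulnSr -(big_mkord xpredT) /=.
rewrite (@big_cat_nat _ _ _ (k * M)) ?leq_addr //=.
rewrite big_mkord; congr addn.
rewrite -[X in \sum_(X <= _ < _) _]add0n [(k * M + k)%N]addnC big_addn addnK big_mkord.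
by [].
Qed.
End HilbIdeal.

(** * The map pi and its rational section *)

Section Pi.
Variables (F : fieldType) (k : nat) (hk : (1 <= k)%N) (d : nat -> nat).
Notation P := {mpoly F[2]}.
Notation px := (px F).
Notation py := (py F).
Notation db := (fun (j : 'I_k) h => d (j + k * h)%N).
Notation data := (data F k d).
Notation ndata := (ndata F hk db).
(** Both sides are the same term; the equation stays a variable because [pi_data] casts along the
    proof supplied to it. *)
Variable Hd : forall (j : 'I_k) h, d (j + k * h)%N = db j h.

Lemma B1pow_mul (x : data) (q : forall j, {linear P -> 'cV[F]_(d j)}) :
  (forall j f, whomog k j f -> q j.+1 (px * f) = B1 x j *m q j f) ->
  forall m j f, whomog k j f -> whomog k (m + j) (px ^+ m * f) /\
    q (m + j)%N (px ^+ m * f) = B1pow x m j *m q j f.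
Proof.
move=> qx m j f hf; elim: m => [|m [IH1 IH2]] /=; first by rewrite !mul1r mul1mx.
rewrite exprS -mulrA; split; first exact: whomog_px.
by rewrite -mulmxA -IH2 -qx.
Qed.

(** The new quotient maps are [q (j + k * h)] after [emb k j]. Along [emb], multiplication by x
    becomes multiplication by x^k, and inclusion of one ideal in the next becomes multiplication by
    x: hence [C1 = B1 ^ k] and [p = B1]. *)
Lemma data_ideal_nested (x : data) I :
  data_ideal x I -> ndata_ideals (pi_data hk Hd x) (to_nested I).
Proof.
move=> [q [qi qs q1 q2 q0]]; exists (fun j h => q (j + k * h)%N \o emb k j); split=> /=.
- by move=> j h f hf; apply: qi; exact: whomog_emb.
- move=> j h v; have [f hf <-] := qs _ v; exists (dec k j f).
    exact: whomog_dec.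
  by rewrite /= (emb_dec hk (h := h)).
- move=> j h f hf; have hf' := whomog_emb hk (ltn_ord j) hf; split.
    rewrite mulmx_castl -(B1pow_mul q1 _ hf').2 -emb_px.
    by rewrite (castmx_colE q) // mulnS; lia.
  rewrite mulmx_castl -(q2 _ _ hf') -emb_py.
  by rewrite (castmx_colE q) // mulnS; lia.
- move=> j h f hf; have hf' := whomog_emb hk (ltn_ord (prevk j)) hf.
  by rewrite mulmx_castl -(q1 _ _ hf') -embS (castmx_colE q).
- rewrite -q0 (castmx_colE q) ?muln0 // /emb mul1r rmorph1 //.
Qed.

Section RationalSection.
Variable y : ndata.

(** Indexed by [nat], with value 0 out of range, so that composites can be defined by recursion. *)
Definition pr_nat m h : 'M[F]_(d (m.+1 + k * h), d (m + k * h)) :=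
  match @idP (m < k.-1)%N with
  | ReflectT lt => pr y (Ordinal lt) h
  | ReflectF _ => 0
  end.

Fixpoint pr_comp m h : 'M[F]_(d (m + k * h), d (firstk hk + k * h)) :=
  match m return 'M[F]_(d (m + k * h), d (firstk hk + k * h)) with
  | 0 => 1%:M
  | m'.+1 => pr_nat m' h *m pr_comp m' h
  end.

(** The choice between the two formulas depends on dimensions only and not on [y], so each entry is
    one fraction on all charted data. *)
Definition wrap_B1 (j : 'I_k) h : 'M[F]_(d (firstk hk + k * h.+1), d (j + k * h)) :=
  if d (j + k * h)%N == d (firstk hk + k * h)%N
  then C1 y (firstk hk) h *m rect_inv (pr_comp j h)
  else rect_inv (pr_comp j h.+1) *m C1 y j h.

Lemma wrap_dim (j : 'I_k) h : j.+1 = k -> d (firstk hk + k * h.+1) = d (j + k * h).+1.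
Proof. by move=> jk; congr d; rewrite -addSn jk mulnS. Qed.

Definition sec_B1 (j : 'I_k) h : 'M[F]_(d (j + k * h).+1, d (j + k * h)) :=
  match @eqP _ j.+1 k with
  | ReflectT e => castmx (wrap_dim h e, erefl _) (wrap_B1 j h)
  | ReflectF _ => pr_nat j h
  end.

Lemma shift_dim (j : 'I_k) h : d (j + k * h.+1) = d (j + k * h + k).
Proof. by congr d; rewrite mulnSr addnA. Qed.

Lemma first_dim : d (firstk hk + k * 0) = d 0.
Proof. by rewrite muln0. Qed.

Definition sec_data : data :=
  {| B1 := interleave hk (T := fun i => 'M[F]_(d i.+1, d i)) sec_B1;
     B2 := interleave hk (T := fun i => 'M[F]_(d (i + k), d i))
       (fun j h => castmx (shift_dim j h, erefl _) (C2 y j h));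
     fr := castmx (first_dim, erefl 1%N) (nfr y) |}.

Variable J : 'I_k -> set P.
Variable q : forall (j : 'I_k) h, {linear P -> 'cV[F]_(d (j + k * h))}.
Hypothesis qs : forall j h v, exists2 f, whomog 1 h f & q j h f = v.
Hypothesis q2 : forall j h f, whomog 1 h f ->
  q (nextk j) h f = pr y j h *m q (prevk j) h f.

Lemma pr_natE (j : 'I_k) h (l' : (j.+1 < k)%N) f : whomog 1 h f ->
  q (Ordinal l') h f = pr_nat j h *m q j h f.
Proof.
case: j l' => m l /= l' hf; rewrite /pr_nat; destruct (@idP (m < k.-1)%N) as [lt|]; last by lia.
(* The bound proofs inside the ordinals are exchanged for those of [nextk] and [prevk], on which
   [q2] is stated. *)
rewrite (bool_irrelevance l' (nextk_subproof (Ordinal lt) : (m.+1 < k)%N)).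
rewrite (bool_irrelevance l (widen_ord_proof (Ordinal lt) (leq_pred k) : (m < k)%N)).
refine (q2 (Ordinal lt) hf).
Qed.

Lemma pr_compE (j : 'I_k) h f : whomog 1 h f ->
  q j h f = pr_comp j h *m q (firstk hk) h f.
Proof.
move=> hf; case: j => m; elim: m => [|m IH] lt /=.
  by rewrite mul1mx /firstk (bool_irrelevance hk lt).
by rewrite -mulmxA -(IH (ltnW lt)); exact: (pr_natE (j := Ordinal (ltnW lt))).
Qed.

(** By [pr_compE] the surjection [q j h] factors through [pr_comp j h], which is therefore onto.
    Preimages of the standard basis vectors are the columns of a right inverse. *)
Lemma pr_comp_free j h : row_free (pr_comp (j : 'I_k) h).
Proof.
apply/row_freeP.
have [v|B hB] := @boolp.choice _ _ (fun (v : 'cV[F]_(d (j + k * h)))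
    (u : 'cV[F]_(d (firstk hk + k * h))) => pr_comp j h *m u = v).
  by have [f hf <-] := qs v; exists (q (firstk hk) h f); rewrite -pr_compE.
exists (\matrix_(a, b) B (delta_mx b 0) a 0); apply/matrixP => a b.
have := congr1 (fun v : 'cV_ _ => v a 0) (hB (delta_mx b 0)).
rewrite !mxE eqxx andbT => <-; apply: eq_bigr => c _.
by rewrite !mxE.
Qed.

Hypothesis q1 : forall j h f, whomog 1 h f ->
  q j h.+1 (px * f) = C1 y j h *m q j h f /\
  q j h.+1 (py * f) = C2 y j h *m q j h f.
Hypothesis gap : forall h, d (k.-1 + k * h) = d (k * h) \/
  d (k.-1 + k * h.+1) = d (k * h.+1).

(* This says that [wrap_B1] is the multiplication by [x] from [V_(k, h)] to
   [V_(1, h + 1)]: by [gap], [pr_comp] is invertible in one of the degrees [h], [h + 1]. *)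
Lemma wrap_B1E (j : 'I_k) h f : j.+1 = k -> whomog 1 h f ->
  q (firstk hk) h.+1 (px * f) = wrap_B1 j h *m q j h f.
Proof.
move=> jk hf; rewrite /wrap_B1; case: eqP => e.
  (* Equal dimensions in degree [h]: the class of [f] is pulled back to the first space and then
     multiplied by x there. *)
  by rewrite (pr_compE j hf) -mulmxA (mulmxA (rect_inv _)) rect_invK ?pr_comp_free //
    mul1mx (q1 _ hf).1.
(* Otherwise [gap] gives equality in degree [h + 1], and the pullback follows the multiplication. *)
have e' : d (j + k * h.+1) = d (firstk hk + k * h.+1).
  by have [] := gap h; rewrite (_ : k.-1 = j) //; rewrite -[k in k.-1]jk.
rewrite -mulmxA -(q1 _ hf).1 (pr_compE j (whomog_px hf)).
by rewrite mulmxA rect_invK ?mul1mx // pr_comp_free.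
Qed.

Hypothesis qi : forall j h f, whomog 1 h f -> (q j h f = 0 <-> J j f).
Hypothesis q0 : q (firstk hk) 0%N 1 = nfr y.
Hypothesis hJ : forall j, is_whomog_ideal 1 (J j).
Hypothesis sJ : forall i j : 'I_k, (i < j)%N -> (J i `<=` J j)%classic.

(** The inclusion of x J_(k-1) in J_0 is checked degree by degree: by [wrap_B1E] the class of x f is
    a matrix times the class of f, which is zero. *)
Lemma is_whomog_ideal_to_hilb : is_whomog_ideal k (to_hilb J).
Proof.
apply: is_whomog_to_hilb => // f i j i0 jk Jf.
have -> : i = firstk hk by exact/val_inj.
apply: (ideal_wcomp (k := 1)); first by case: (hJ (firstk hk)).
case=> [|h]; first by rewrite wcomp_px0; case: (hJ (firstk hk)) => -[].
rewrite wcomp_px; have hf := @wcomp_homog F 1 h f.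
apply/(qi _ (whomog_px hf)); rewrite (@wrap_B1E j) //; last by rewrite jk prednK.
have -> : q j h (wcomp 1 h f) = 0; last by rewrite mulmx0.
by apply/qi => //; case: (hJ j) => _; apply.
Qed.

(** The quotient map in degree [j + k * h] is [q j h] after [dec k j]; the shift rules [dec_px],
    [dec_px_last] and [dec_py] give the matrices. *)
Lemma data_ideal_sec : data_ideal sec_data (to_hilb J).
Proof.
pose Q := interleave hk (T := fun i => {linear P -> 'cV[F]_(d i)})
  (fun (j : 'I_k) h => (q j h \o dec k j : {linear P -> 'cV[F]_(d (j + k * h))})).
have QE (j : 'I_k) h f : Q (j + k * h)%N f = q j h (dec k j f).
  by rewrite /Q interleaveE.
exists Q; split=> [i f|i|i f|i f|].
- move: f; pattern i; apply: (nat_decomp_ind hk) => {i} j h f hf.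
  rewrite QE; apply: (iff_trans (qi j (whomog_dec hk (ltn_ord j) hf))).
  split=> [Jf i|/(_ j)//].
  have [->//|ij] := eqVneq i j.
  rewrite -(wcomp_id hf) dec_wcomp // val_eqE (negPf ij).
  by case: (hJ i) => -[].
- pattern i; apply: (nat_decomp_ind hk) => {i} j h v.
  have [f hf <-] := qs v; exists (emb k j f); first exact: whomog_emb.
  by rewrite QE dec_emb // eqxx.
- move: f; pattern i; apply: (nat_decomp_ind hk) => {i} j h f hf.
  have hf' := whomog_dec hk (ltn_ord j) hf.
  (* For the last residue the target degree is [k * h.+1], where [wrap_B1] acts; for the others
     multiplication by x is [pr]. *)
  rewrite /= interleaveE QE /sec_B1; destruct (@eqP _ j.+1 k) as [e|ne].
    rewrite mulmx_castl -wrap_B1E // -[X in dec k X f](_ : k.-1 = j); last by rewrite -[k in k.-1]e.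
    rewrite -dec_px_last // -QE (castmx_colE Q) //.
    by rewrite -addSn e mulnS.
  have lt : (j.+1 < k)%N by have := ltn_ord j; lia.
  have := QE (Ordinal lt) h (px * f).
  rewrite /= dec_px // => E; rewrite [LHS]E.
  exact: pr_natE.
- move: f; pattern i; apply: (nat_decomp_ind hk) => {i} j h f hf.
  have hf' := whomog_dec hk (ltn_ord j) hf.
  rewrite /= interleaveE QE mulmx_castl -(q1 _ hf').2 -dec_py // -QE.
  by rewrite (castmx_colE Q) // mulnSr addnA.
- have := QE (firstk hk) 0%N 1; rewrite dec1 // q0 => E.
  by rewrite /= -E (castmx_colE Q) // muln0.
Qed.
End RationalSection.
End Pi.

(** * The isomorphism *)

Section Isomorphism.
Variables (F : fieldType) (k : nat) (hk : (1 <= k)%N) (d : nat -> nat) (n : nat).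
Notation db := (fun (j : 'I_k) h => d (j + k * h)%N).
Variable Hd : forall (j : 'I_k) h, d (j + k * h)%N = db j h.

Lemma polymx_B1pow m j : polymx (@data_coord F k d) (fun x => B1pow x m j).
Proof.
elim: m => [|m IH] /=; first by move=> a b; exact: polyfun_const.
by apply: polymx_mul => // a b; apply: polyfun_coord; exact: coord_B1.
Qed.

Lemma polyfun_pi_data c : @ndata_coord F k hk db c ->
  polyfun (@data_coord F k d) (c \o pi_data hk Hd).
Proof.
case=> [j h|j h|j h|].
- exact/polymx_cast/polymx_B1pow.
- by apply: polymx_cast => a b; apply: polyfun_coord; exact: coord_B2.
- by apply: polymx_cast => a b; apply: polyfun_coord; exact: coord_B1.
- move=> a; have := @polymx_cast F _ (@data_coord F k d) _ _ _ _
    (Hd_first hk Hd, erefl 1%N) (@fr F k d).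
  by apply=> {}a b; rewrite ord1; apply: polyfun_coord; exact: coord_fr.
Qed.

(** The dimensions are read off the quotient maps carried over from quiver data representing [I]. *)
Lemma nested_ideals_to_nested (I : set {mpoly F[2]}) :
  hilb_ideal k n d I -> nested_ideals db (to_nested I).
Proof.
move=> hI; have [x /(data_ideal_nested hk Hd)[q [qi qs _ _ _]]] := data_ideal_surj hI.
have [hI' _ _] := hI; split=> [j|i j /ltnW ij|j h].
- exact: is_whomog_to_nested.
- by apply: to_nested_sub => //; case: hI'.
- apply: (quot_dimP (q := q j h)); [exact: whomog0| |exact: qs|exact: qi].
  by move=> c f g; exact: whomog_lin.
Qed.

Hypothesis gap : forall h, d (k.-1 + k * h) = d (k * h) \/
  d (k.-1 + k * h.+1) = d (k * h.+1).
Hypothesis sum_d : sums_to d n.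

Lemma data_ideal_sec_nested (y : ndata F hk db) J :
  nested_ideals db J -> ndata_ideals y J ->
  is_whomog_ideal k (to_hilb J) /\ data_ideal (sec_data y) (to_hilb J).
Proof.
move=> [hJ sJ _] [q [qi qs q1 q2 q0]]; split.
  exact: (is_whomog_ideal_to_hilb (q := q) (y := y)).
exact: (data_ideal_sec (q := q)).
Qed.

Lemma hilb_ideal_to_hilb (J : 'I_k -> set {mpoly F[2]}) :
  nested_ideals db J -> hilb_ideal k n d (to_hilb J).
Proof.
move=> hJ; have [y yJ] := ndata_ideals_surj hk hJ.
by have [? ?] := data_ideal_sec_nested hJ yJ; exact: (data_ideal_hilb (x := sec_data y)).
Qed.

Notation charted := (fun y => exists w, @nested_chart F k hk db y w).

Lemma polymx_pr_comp m h :
  polymx (@ndata_coord F k hk db) (fun y => pr_comp y m h).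
Proof.
elim: m => [|m IH] /=; first by move=> a b; exact: polyfun_const.
apply: polymx_mul => //; rewrite /pr_nat; case: {-}_ / idP => [lt|_] a b.
  by apply: polyfun_coord; exact: coord_pr.
exact: polyfun_const.
Qed.

Lemma ratmx_rect_inv_pr_comp (j : 'I_k) h :
  d (j + k * h) = d (firstk hk + k * h) ->
  ratmx (@ndata_coord F k hk db) charted (fun y => rect_inv (pr_comp y j h)).
Proof.
move=> e; apply: ratmx_rect_inv => //; first exact: polymx_pr_comp.
move=> y [w [_ _ [q [_ qs _ q2 _]]]]; exact: (pr_comp_free qs q2).
Qed.

(** Only the last residue brings in denominators: determinants of [pr_comp] in a degree where it is
    square, hence invertible on charted data. *)
Lemma ratmx_sec_B1 (j : 'I_k) h :
  ratmx (@ndata_coord F k hk db) charted (fun y => sec_B1 y j h).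
Proof.
rewrite /sec_B1; case: {-}_ / eqP => [e|_]; last first.
  apply: polymx_ratmx; rewrite /pr_nat; case: {-}_ / idP => [lt|_] a b.
    by apply: polyfun_coord; exact: coord_pr.
  exact: polyfun_const.
apply: ratmx_cast; rewrite /wrap_B1; case: eqP => e'.
  apply: ratmx_mul; last exact: ratmx_rect_inv_pr_comp.
  by apply: polymx_ratmx => a b; apply: polyfun_coord; exact: coord_C1.
apply: ratmx_mul; last by apply: polymx_ratmx => a b; apply: polyfun_coord; exact: coord_C1.
apply: ratmx_rect_inv_pr_comp.
by have [] := gap h; rewrite (_ : k.-1 = j) //; rewrite -[k in k.-1]e.
Qed.

Lemma ratfun_sec_data c : @data_coord F k d c ->
  ratfun (@ndata_coord F k hk db) charted (c \o @sec_data F k hk d).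
Proof.
case=> [i|i|].
- elim/(nat_decomp_ind hk): i => j h a b.
  by apply: eq_ratfun (@ratmx_sec_B1 j h a b) => y _; rewrite /= interleaveE.
- elim/(nat_decomp_ind hk): i => j h a b.
  have := @ratmx_cast F _ (@ndata_coord F k hk db) charted _ _ _ _
    (shift_dim d j h, erefl _) (fun y => C2 y j h).
  move=> /(_ _ a b) R; apply: eq_ratfun (R _) => [y _|a' b'].
    by rewrite /= interleaveE.
  by apply/polyfun_ratfun/polyfun_coord; exact: coord_C2.
- move=> a; have := @ratmx_cast F _ (@ndata_coord F k hk db) charted _ _ _ _
    (first_dim hk d, erefl 1%N) (@nfr F k hk db).
  move=> /(_ _ a 0); apply=> {}a b; rewrite ord1.
  by apply/polyfun_ratfun/polyfun_coord; exact: coord_nfr.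
Qed.

Definition nested_of_hilb (z : hilb F k d n) : nested_hilb F hk db :=
  exist _ (to_nested (sval z)) (nested_ideals_to_nested (svalP z)).

Definition hilb_of_nested (w : nested_hilb F hk db) : hilb F k d n :=
  exist _ (to_hilb (sval w)) (hilb_ideal_to_hilb (svalP w)).

(** Relations and stability of the image are deduced from the ideals that it represents. *)
Lemma nested_of_hilb_chart x z :
  hilb_chart x z -> nested_chart (pi_data hk Hd x) (nested_of_hilb z).
Proof.
move=> [_ _ /(data_ideal_nested hk Hd) xz]; split=> //.
- exact: ndata_ideals_rel xz.
- exact: ndata_ideals_stable xz.
Qed.

Lemma hilb_of_nested_chart (y : ndata F hk db) w :
  nested_chart y w -> hilb_chart (sec_data y) (hilb_of_nested w).
Proof.
move=> [_ _ /(data_ideal_sec_nested (svalP w))[_ yw]]; split=> //.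
- exact: data_ideal_rel yw.
- exact: data_ideal_stable yw.
Qed.

Lemma nested_of_hilb_iso : is_isomorphism nested_of_hilb.
Proof.
split.
  apply: (quotient_morphism nested_of_hilb_chart) => c hc.
  exact/polyfun_ratfun/polyfun_pi_data.
exists hilb_of_nested; split.
- apply: (quotient_morphism hilb_of_nested_chart) => c hc.
  exact: ratfun_sec_data.
- move=> [I hI]; apply: eq_exist; by apply: (to_nestedK hk); have [] := hI.
- move=> [J hJ]; apply: eq_exist; apply: (to_hilbK hk) => j.
  by have [/(_ j)[]] := hJ.
Qed.
End Isomorphism.

Theorem proposition7p2 (R : realType) (k : nat) (hk : (1 <= k)%N)
  (nb : 'I_k -> nat) (db : 'I_k -> nat -> nat) (n : nat) (d : nat -> nat)
  (nb_noninc : forall i j : 'I_k, (i <= j)%N -> (nb j <= nb i)%N)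
  (db_sum : forall i, sums_to (db i) (nb i))
  (n_def : n = (\sum_(i < k) nb i)%N)
  (d_def : forall (i : 'I_k) (j : nat), d (i + k * j)%N = db i j)
  (gap : forall i j : nat, ~ eq_degrees db i -> ~ eq_degrees db j ->
     (i < j)%N -> (2 <= j - i)%N) :
  exists pi : hilb R[i] k d n -> nested_hilb R[i] hk db,
    (forall x z, hilb_chart x z -> nested_chart (pi_data hk d_def x) (pi z)) /\
    is_isomorphism pi.
Proof.
(* With [db] expressed through [d], the sections above apply and [d_def] takes the role of [Hd]. *)
have dbE : db = (fun (j : 'I_k) h => d (j + k * h)%N).
  by apply/funext => j; apply/funext => h; rewrite d_def.
subst db.
have last_k : (k.-1 < k)%N by rewrite prednK.
have ext h : ~ eq_degrees (fun (j : 'I_k) h => d (j + k * h)%N) h \/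
    d (k.-1 + k * h)%N = d (k * h)%N.
  have [e|] := eqVneq (d (k.-1 + k * h)%N) (d (k * h)%N); first by right.
  by move=> /eqP ne; left=> /(_ (Ordinal last_k) (firstk hk)).
(* Degrees [h] and [h.+1] differ by 1, so they cannot both lie outside [eq_degrees]. *)
have gap' h : d (k.-1 + k * h)%N = d (k * h)%N \/
    d (k.-1 + k * h.+1)%N = d (k * h.+1)%N.
  have [nh|] := ext h; last by left.
  have [nh'|] := ext h.+1; last by right.
  by have := gap _ _ nh nh' (ltnSn h); rewrite subSnn.
have sum_d : sums_to d n by rewrite n_def; exact: sums_to_interleave.
exists (nested_of_hilb hk (n := n) d_def); split.
  by move=> x z; exact: nested_of_hilb_chart.
exact: nested_of_hilb_iso.
Qed.
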